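(* Let $A$ be a self-adjoint operator on an infinite-dimensional Hilbert space $\mathcal{H}$, $\gamma\in\rho(A)\cap\mathbb{R}$, $\kappa\in\mathbb{R}$, let $B,C$ be bounded symmetric operators on $\mathcal{H}$ satisfying $0\le C\le B$ and $\lVert B\rVert<\operatorname{dist}^{\leftarrow}(\gamma,\sigma(A))$, and let $E>\gamma$. (1) If $\langle x,Bx\rangle\ge\kappa\lVert x\rVert^2$ for all $x\in\operatorname{Ran}P_{A+B}(E)$, then for all $k\in\mathbb{N}\cup\{\infty\}$ with $\lambda^{\rightarrow}_{k,\gamma}(A+B)<E$ we have $$\lambda^{\rightarrow}_{k,\gamma}(A+B)\ \ge\ \lambda^{\rightarrow}_{k,\gamma}(A)+\kappa.$$ (2) If $\langle x,Bx\rangle\ge\langle x,Cx\rangle$ for all $x\in\operatorname{Ran}P_{A+B}(E)$, then for all $k\in\mathbb{N}\cup\{\infty\}$ with $\lambda^{\rightarrow}_{k,\gamma}(A+B)<E$ we have $$\lambda^{\rightarrow}_{k,\gamma}(A+B)\ \ge\ \lambda^{\rightarrow}_{k,\gamma}(A+C).$$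
   Context: $P_A(E)=\mathbf{1}_{(-\infty,E]}(A)$ is the spectral projection of a self-adjoint operator $A$. $A$ need not be semi-bounded. For $\gamma\in\rho(A)\cap\mathbb{R}$, $\operatorname{dist}^{\leftarrow}(\gamma,\sigma(A))=\gamma-\sup(\sigma(A)\cap(-\infty,\gamma])$, equal to $\infty$ if $\gamma<\inf\sigma(A)$. Set $\lambda^{\rightarrow}_{\infty,\gamma}(A)=\inf\{\lambda>\gamma:\lambda\in\sigma_{\mathrm{ess}}(A)\}$ ($=\infty$ if there is no essential spectrum above $\gamma$). $(\lambda^{\rightarrow}_{k,\gamma}(A))_{k\in\mathbb{N}}$ denotes the eigenvalues of $A$ in $(\gamma,\lambda^{\rightarrow}_{\infty,\gamma}(A))$, enumerated non-decreasingly and counting multiplicities; if there are exactly $N\in\mathbb{N}_0$ of them, one sets $\lambda^{\rightarrow}_{k,\gamma}(A)=\lambda^{\rightarrow}_{\infty,\gamma}(A)$ for all $k>N$. *)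

(* Defs.v *)
From HB Require Import structures.
From mathcomp Require Import all_boot all_order all_algebra.
From mathcomp Require Import complex sesquilinear.
From mathcomp Require Import all_classical all_reals all_analysis.

Set Implicit Arguments.
Unset Strict Implicit.
Unset Printing Implicit Defensive.

Import Order.TTheory GRing.Theory Num.Theory.
Import numFieldNormedType.Exports.

Local Open Scope classical_set_scope.
Local Open Scope complex_scope.
Local Open Scope ring_scope.

(* A possibly unbounded linear operator: only the values of [op_fun] on the
   subspace [op_dom] are meaningful. *)
Record operator (R : realType) (H : completeNormedModType R[i]) := Operator {
  op_dom : set H ;
  op_fun :> H -> H ;
  op_dom0 : op_dom 0 ;
  op_domP : forall (a : R[i]) (x y : H),
    op_dom x -> op_dom y -> op_dom (a *: x + y) ;
  op_linear : forall (a : R[i]) (x y : H),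
    op_dom x -> op_dom y -> op_fun (a *: x + y) = a *: op_fun x + op_fun y
}.

Section Operators.
Context {R : realType} {H : completeNormedModType R[i]}.
Implicit Types (T : operator H) (B : {linear H -> H}) (V : set H).

Lemma op_add_linear T B (a : R[i]) (x y : H) : op_dom T x -> op_dom T y ->
  T (a *: x + y) + B (a *: x + y) = a *: (T x + B x) + (T y + B y).
Proof.
by move=> Tx Ty; rewrite op_linear// linearP scalerDr addrACA.
Qed.

Definition op_add T B : operator H :=
  Operator (op_dom0 T) (@op_domP _ _ T) (@op_add_linear T B).

Definition has_dim V (m : nat) : Prop :=
  exists e : 'I_m -> H,
    (forall c : 'I_m -> R[i],
       \sum_(i < m) c i *: e i = 0 -> forall i, c i = 0) /\
    V = range (fun c : 'I_m -> R[i] => \sum_(i < m) c i *: e i).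

Definition infinite_dim V : Prop := forall m, ~ has_dim V m.

Definition opnorm (B : H -> H) : \bar R :=
  ereal_sup [set (complex.Re `|B x|)%:E | x in [set x : H | `|x| <= 1]].

Definition resolvent_set T : set R[i] :=
  [set z | exists S : {linear H -> H},
    [/\ continuous S,
        forall y, op_dom T (S y) /\ T (S y) - z *: S y = y
      & forall x, op_dom T x -> S (T x - z *: x) = x]].

(* The real part of the spectrum; for self-adjoint operators this is all of
   the spectrum. *)
Definition spectrum T : set R := [set l | ~ resolvent_set T l%:C].

Definition op_eigenspace T (l : R) : set H :=
  [set x | op_dom T x /\ T x = l%:C *: x].

Definition discrete_spectrum T : set R :=
  [set l | isolated (spectrum T) l /\
           exists m, (0 < m)%N /\ has_dim (op_eigenspace T l) m].

Definition ess_spectrum T : set R := spectrum T `\` discrete_spectrum T.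

Definition dist_left (g : R) (S : set R) : \bar R :=
  (g%:E - ereal_sup [set l%:E | l in S `&` [set l | (l <= g)%R]])%E.

Definition gap_eig_infty T (g : R) : \bar R :=
  ereal_inf [set l%:E | l in ess_spectrum T `&` [set l | g < l]].

(* [s] (indexed from 0) lists the eigenvalues in (g, gap_eig_infty T g)
   non-decreasingly, each repeated according to its multiplicity. The only
   other value [s] may take is [gap_eig_infty T g], which therefore pads the
   sequence when there are finitely many eigenvalues. *)
Definition enumerates_gap_eigs T (g : R) (s : nat -> \bar R) : Prop :=
  [/\ nondecreasing_seq s,
      forall k, (g%:E < s k <= gap_eig_infty T g)%E
    & forall l : R, g < l -> (l%:E < gap_eig_infty T g)%E ->
        exists m, has_dim (op_eigenspace T l) m /\ ([set k | s k = l%:E] #= `I_m)%card].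

Definition gap_eigs T (g : R) : nat -> \bar R :=
  xget (fun=> gap_eig_infty T g) [set s | enumerates_gap_eigs T g s].

(* [Some k] is the (k+1)-st eigenvalue above g, and [None] the index oo. *)
Definition gap_eig T (g : R) (k : option nat) : \bar R :=
  if k is Some n then gap_eigs T g n else gap_eig_infty T g.

End Operators.

Section InnerProduct.
Context {R : realType} {H : completeNormedModType R[i]}.
Variable ip : {dot H for (@Num.conj R[i])}.
Implicit Types (T : operator H) (P : set R -> H -> H).

Definition self_adjoint T : Prop :=
  dense (op_dom T) /\
  forall y z, (forall x, op_dom T x -> ip (T x) y = ip x z) <->
              (op_dom T y /\ T y = z).

Definition symmetric_op (B : H -> H) : Prop :=
  forall x y, ip (B x) y = ip x (B y).

Definition orthogonal_projection (Q : H -> H) : Prop :=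
  [/\ linear Q, (forall x, Q (Q x) = Q x) & symmetric_op Q].

(* [P] is the projection-valued measure on the Borel sets of the real line
   with T = \int l dP(l), [mu] being the measure S |-> <P(S) x, x>. *)
Definition spectral_measure T P : Prop :=
  [/\ forall S, measurable S -> orthogonal_projection (P S),
      forall x, P setT x = x
    & forall x, exists mu : {measure set (measurableTypeR R) -> \bar R},
      [/\ forall S, measurable S -> mu S = (complex.Re (ip (P S x) x))%:E,
          op_dom T x <-> (\int[mu]_l (l ^+ 2)%:E < +oo)%E
        & op_dom T x -> ip (T x) x = (\int[mu]_l l)%:C]].

(* For self-adjoint T the spectral theorem provides a unique such measure
   (on Borel sets), so the default value is never used. *)
Definition the_spectral_measure T : set R -> H -> H :=
  xget (fun _ : set R => id : H -> H) [set P | spectral_measure T P].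

Definition spectral_proj T (E : R) : H -> H :=
  the_spectral_measure T `]-oo, E].

End InnerProduct.

(* Main.v *)
(* With [SA = (A - gamma)^-1] and [SB = (A + B - gamma)^-1], an eigenvalue lambda above
   gamma corresponds to the positive eigenvalue [1 / (lambda - gamma)] of the bounded
   resolvent, so the eigenvalues above gamma are given from below by the usual
   min-max principle for the resolvent. Since [SA >= -1/d] with [d] the distance to the
   spectrum on the left of gamma and [B < d], gamma stays in the resolvent set and
   [SB <= SC] whenever [0 <= C <= B], which is (2).

   For (1) with kappa > 0, let [p0] and [Q] be the spectral projections of A + B up
   to gamma and up to E. A trial space on which [SB >= nu > 1 / (E - gamma)] may be
   projected into [Ran (Q - p0)]. For [v] in that range there is a [u] orthogonal to
   [Ran p0] such that [SA u] is [SB v] plus an element of [Ran p0]; as [SA >= SB >= 0]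
   on the complement of [Ran p0], Cauchy--Schwarz for the form of [SA] there, together
   with [B >= kappa] on [Ran Q], gives [SA >= nu / (1 - kappa nu)] on the projected
   trial space, that is, eigenvalues of A lower by kappa.

   If A + B had no spectral measure, the hypothesis of (1) would hold on the
   whole space, by the default value [id] in [the_spectral_measure]; (1) then follows
   by comparing B with the constant kappa, so the spectral theorem is not invoked. *)
Require Import Defs.
From HB Require Import structures.
From mathcomp Require Import all_boot all_order all_algebra.
From mathcomp Require Import complex sesquilinear.
From mathcomp Require Import all_classical all_reals all_analysis.
From mathcomp Require Import measurable_realfun.
From mathcomp Require Import ring lra.

Set Implicit Arguments.
Unset Strict Implicit.
Unset Printing Implicit Defensive.

Import Order.TTheory GRing.Theory Num.Theory.
Import numFieldNormedType.Exports.

Local Open Scope classical_set_scope.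
Local Open Scope complex_scope.
Local Open Scope ring_scope.

(** Since A need not be semi-bounded, its own quadratic form gives no min-max principle above gamma;
    that part of the spectrum is the positive part of the spectrum of a bounded operator, the
    resolvent. Spectral theory of the resolvent is replaced by one fact on symmetric f: if f - m is
    bounded below on an invariant subspace for all m < m0, then the form of f is at least m0 there
    ([form_ge]). Applied to f, to (f - c)^2 and to complements of eigenvectors, it yields gaps,
    isolated points and min-max. In (1) the obstacle is that the spectral projections of A + B
    commute with SB but in general not with SA, and that SA may be indefinite, so that
    Cauchy--Schwarz for its form is used only on Ker p0. The resolvent identity gives SA (v - B SB
    v) = SB v, but v - B SB v may leave Ker p0; the element z of Ran p0 in [gap_shift_bound] brings
    it back. The constant nu / (1 - kappa nu) is 1 / (1 / nu - kappa): with nu = 1 / (lambda -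
    gamma) it is the resolvent value belonging to lambda - kappa. *)

Section RealForm.
Context {R : realType} {H : completeNormedModType R[i]}.
Variable ip : {dot H for (@Num.conj R[i])}.
Hypothesis ip_norm : forall x : H, ip x x = `|x| ^+ 2.

(* Most of the argument takes place in the real Hilbert space (H, Re ip), with
   operators that are raw functions, linear over R. *)
Definition rip (x y : H) : R := complex.Re (ip x y).
Definition nrm (x : H) : R := complex.Re `|x|.

Lemma nrmE x : `|x| = (nrm x)%:C.
Proof. by rewrite /nrm RRe_real// ger0_real. Qed.

Lemma nrm_ge0 x : 0 <= nrm x.
Proof. by rewrite -ler0c -nrmE. Qed.

Lemma ripxx x : rip x x = nrm x ^+ 2.
Proof. by rewrite /rip ip_norm nrmE -rmorphXn. Qed.

Lemma ReD (a b : R[i]) : complex.Re (a + b) = complex.Re a + complex.Re b.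
Proof. by case: a b => [? ?] [? ?]. Qed.
Lemma ReZ (a : R) (b : R[i]) : complex.Re (a%:C * b) = a * complex.Re b.
Proof. by case: b => ? ? /=; rewrite mul0r subr0. Qed.
Lemma Re_conj (a : R[i]) : complex.Re (Num.conj a) = complex.Re a.
Proof. by case: a. Qed.
Lemma conj_real (a : R) : Num.conj a%:C = a%:C :> R[i].
Proof. by rewrite /Num.conj/= oppr0. Qed.

Lemma ipC x y : ip x y = Num.conj (ip y x).
Proof. by rewrite (hermitian_subproof (s := ip)) mul1r. Qed.

Lemma ripC x y : rip x y = rip y x.
Proof. by rewrite /rip ipC Re_conj. Qed.
Lemma ripDl x y z : rip (x + y) z = rip x z + rip y z.
Proof. by rewrite /rip linearDl ReD. Qed.
Lemma ripZl (a : R) x z : rip (a%:C *: x) z = a * rip x z.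
Proof. by rewrite /rip linearZl_LR/= ReZ. Qed.
Lemma ripDr x y z : rip z (x + y) = rip z x + rip z y.
Proof. by rewrite ripC ripDl !(ripC z). Qed.
Lemma ripZr (a : R) x z : rip z (a%:C *: x) = a * rip z x.
Proof. by rewrite ripC ripZl (ripC z). Qed.
Lemma ripNl x z : rip (- x) z = - rip x z.
Proof. by have := ripZl (-1) x z; rewrite rmorphN1 scaleN1r mulN1r. Qed.
Lemma ripNr x z : rip z (- x) = - rip z x.
Proof. by rewrite ripC ripNl (ripC z). Qed.
Lemma rip0l z : rip 0 z = 0.
Proof. by have := ripZl 0 0 z; rewrite scaler0 mul0r. Qed.
Lemma rip0r z : rip z 0 = 0. Proof. by rewrite ripC rip0l. Qed.
Definition ripE := (ripDl, ripDr, ripZl, ripZr, ripNl, ripNr, rip0l, rip0r).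

Lemma nrm0 : nrm 0 = 0. Proof. by rewrite /nrm normr0. Qed.
Lemma nrm_eq0 x : nrm x = 0 -> x = 0.
Proof. by move=> x0; apply/normr0_eq0; rewrite nrmE x0. Qed.
Lemma nrm_gt0 x : x <> 0 -> 0 < nrm x.
Proof. by move=> x0; rewrite lt_neqAle nrm_ge0 andbT eq_sym; apply/eqP => /nrm_eq0. Qed.
Lemma nrmD x y : nrm (x + y) <= nrm x + nrm y.
Proof. by rewrite -lecR rmorphD/= -!nrmE ler_normD. Qed.
Lemma nrmN x : nrm (- x) = nrm x. Proof. by rewrite /nrm normrN. Qed.
Lemma nrmB x y : nrm (x - y) <= nrm x + nrm y.
Proof. by rewrite -(nrmN y) nrmD. Qed.
Lemma nrmZc (a : R[i]) x : nrm (a *: x) = complex.Re `|a| * nrm x.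
Proof.
rewrite /nrm normrZ nrmE; have /RRe_real <- : `|a| \is Num.real by rewrite ger0_real.
by rewrite ReZ.
Qed.
Lemma normcR (a : R) : complex.Re `|a%:C| = `|a|.
Proof. by rewrite normc_def/= expr0n/= addr0 sqrtr_sqr. Qed.
Lemma nrmZ (a : R) x : nrm (a%:C *: x) = `|a| * nrm x.
Proof. by rewrite nrmZc normcR. Qed.

Lemma discr_le (a b c : R) :
  (forall s t, 0 <= s ^+ 2 * a + 2 * s * t * b + t ^+ 2 * c) -> b ^+ 2 <= a * c.
Proof.
move=> q; have a0 : 0 <= a by have := q 1 0; lra.
have [a_eq0|a_neq0] := eqVneq a 0.
  have [->|b0] := eqVneq b 0; first by rewrite a_eq0; lra.
  (* With a = 0 and t = 1 the form is 2 s b + c, and this s makes it -1. *)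
  have := q (- (c + 1) / (2 * b)) 1; rewrite a_eq0.
  have -> : 2 * (- (c + 1) / (2 * b)) * 1 * b = - (c + 1) by field.
  lra.
have a_gt0 : 0 < a by rewrite lt_neqAle eq_sym a_neq0.
have := q (- b) a.
have -> : (- b) ^+ 2 * a + 2 * - b * a * b + a ^+ 2 * c = a * (a * c - b ^+ 2) by ring.
by rewrite pmulr_rge0// subr_ge0.
Qed.

Lemma cauchy_schwarz x y : `|rip x y| <= nrm x * nrm y.
Proof.
have : rip x y ^+ 2 <= rip x x * rip y y.
  apply: discr_le => s t; have := sqr_ge0 (nrm (s%:C *: x + t%:C *: y)).
  by rewrite -ripxx !ripE (ripC y x); lra.
rewrite !ripxx -exprMn -[rip x y ^+ 2]real_normK ?num_real// => h.
by rewrite -ler_sqr ?nnegrE// mulr_ge0 ?nrm_ge0.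
Qed.

Lemma rip_ext x y : (forall w, rip x w = rip y w) -> x = y.
Proof.
move=> xy; apply/subr0_eq/nrm_eq0/eqP; rewrite -sqrf_eq0 -ripxx.
by rewrite ripDl ripNl xy subrr.
Qed.

(** * Bounded symmetric operators on invariant real subspaces *)

Definition rsub (G : set H) :=
  G 0 /\ forall (a : R) x y, G x -> G y -> G (a%:C *: x + y).

Lemma rsubT : rsub setT. Proof. by []. Qed.

Lemma rsubZ G a x : rsub G -> G x -> G (a%:C *: x).
Proof. by case=> G0 GD Gx; rewrite -[_ *: _]addr0; exact: GD. Qed.
Lemma rsubD G x y : rsub G -> G x -> G y -> G (x + y).
Proof. by case=> G0 GD Gx Gy; have := GD 1 x y Gx Gy; rewrite scale1r. Qed.
Lemma rsubN G x : rsub G -> G x -> G (- x).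
Proof. by move=> rG /(rsubZ (-1) rG); rewrite rmorphN1 scaleN1r. Qed.
Lemma rsubB G x y : rsub G -> G x -> G y -> G (x - y).
Proof. by move=> rG Gx /(rsubN rG); exact: rsubD. Qed.

Definition rlin (f : H -> H) := forall (a : R) x y, f (a%:C *: x + y) = a%:C *: f x + f y.
Definition bnd (f : H -> H) := exists2 M, 0 < M & forall x, nrm (f x) <= M * nrm x.
Definition rsym (f : H -> H) := forall x y, rip (f x) y = rip x (f y).
Definition bop f := [/\ rlin f, bnd f & rsym f].
Definition bounded_below_on (G : set H) (f : H -> H) :=
  exists2 c, 0 < c & forall x, G x -> c * nrm x <= nrm (f x).
Definition shift (f : H -> H) (nu : R) x := f x - nu%:C *: x.
(** For bounded symmetric f this is membership of nu in the resolvent set, because a lower bound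
    already forces surjectivity ([bop_onto]). *)
Definition reg f nu := bounded_below_on setT (shift f nu).

Lemma rlin0 f : rlin f -> f 0 = 0.
Proof.
by move=> fl; have := fl (-1) 0 0; rewrite rmorphN1 !scaleN1r oppr0 addr0 addNr.
Qed.
Lemma rlinD f x y : rlin f -> f (x + y) = f x + f y.
Proof. by move=> fl; have := fl 1 x y; rewrite !scale1r. Qed.
Lemma rlinZ f a x : rlin f -> f (a%:C *: x) = a%:C *: f x.
Proof. by move=> fl; have := fl a x 0; rewrite !addr0 rlin0 // addr0. Qed.
Lemma rlinN f x : rlin f -> f (- x) = - f x.
Proof. by move=> /(rlinZ (-1) x); rewrite !rmorphN1 !scaleN1r. Qed.
Lemma rlinB f x y : rlin f -> f (x - y) = f x - f y.
Proof. by move=> fl; rewrite rlinD// rlinN. Qed.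

Lemma linear_rlin (f : {linear H -> H}) : rlin f.
Proof. by move=> a x y; rewrite linearP. Qed.
Hint Resolve linear_rlin : core.

Lemma rlin_comp f g : rlin f -> rlin g -> rlin (f \o g).
Proof. by move=> fl gl a x y /=; rewrite gl fl. Qed.
Lemma bnd_comp f g : bnd f -> bnd g -> bnd (f \o g).
Proof.
move=> [M M0 fM] [N N0 gN]; exists (M * N); first exact: mulr_gt0.
move=> x /=; apply: le_trans (fM _) _; rewrite -mulrA ler_wpM2l//; exact: ltW.
Qed.
Lemma rlin_shift f nu : rlin f -> rlin (shift f nu).
Proof.
move=> fl a x y; rewrite /shift fl !scalerDr !scalerA (mulrC nu%:C) -scalerA scalerN.
by rewrite opprD addrACA.
Qed.
Lemma bnd_shift f nu : bnd f -> bnd (shift f nu).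
Proof.
move=> [M M0 fM]; exists (M + `|nu|); first by rewrite ltr_pwDl.
by move=> x; apply: le_trans (nrmB _ _) _; rewrite nrmZ mulrDl lerD2r.
Qed.
Lemma rsym_shift f nu : rsym f -> rsym (shift f nu).
Proof. by move=> fs x y; rewrite /shift !ripE fs. Qed.
Lemma bop_shift f nu : bop f -> bop (shift f nu).
Proof.
by move=> [? ? ?]; split; [exact: rlin_shift|exact: bnd_shift|exact: rsym_shift].
Qed.
Lemma bop_sq f : bop f -> bop (f \o f).
Proof.
move=> [fl fb fs]; split; [exact: rlin_comp|exact: bnd_comp|].
by move=> x y /=; rewrite fs fs.
Qed.
Lemma bop_opp f : bop f -> bop (fun x => - f x).
Proof.
move=> [fl [M M0 fM] fs]; split.
- by move=> a x y; rewrite fl opprD scalerN.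
- by exists M => // x; rewrite nrmN.
- by move=> x y; rewrite ripNl ripNr fs.
Qed.

Lemma psd_cs f G : rlin f -> rsym f -> rsub G -> (forall x, G x -> 0 <= rip x (f x)) ->
  forall x y, G x -> G y -> rip x (f y) ^+ 2 <= rip x (f x) * rip y (f y).
Proof.
move=> fl fs rG f0 x y Gx Gy; apply: discr_le => s t.
have := f0 (s%:C *: x + t%:C *: y) (rG.2 _ _ _ Gx (rsubZ t rG Gy)).
by rewrite fl (rlinZ _ _ fl) !ripE -(fs y x) (ripC (f y)); lra.
Qed.

(** Cauchy--Schwarz for the form of f at the pair x, f x; as G is invariant, the upper bound M
    applies at f x too. *)
Lemma psd_sq f G M : rlin f -> rsym f -> rsub G ->
  (forall x, G x -> 0 <= rip x (f x) <= M * nrm x ^+ 2) -> (forall x, G x -> G (f x)) ->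
  forall x, G x -> nrm (f x) ^+ 2 <= M * rip x (f x).
Proof.
move=> fl fs rG fM fG x Gx.
have f0 y : G y -> 0 <= rip y (f y) by move=> /fM/andP[].
have := psd_cs fl fs rG f0 Gx (fG _ Gx); rewrite -fs ripxx => cs.
have [->|/nrm_gt0 fx0] := pselect (f x = 0); first by rewrite nrm0 rip0r mulr0 expr0n.
have /andP[_ fM1] := fM _ (fG _ Gx).
have h := le_trans cs (ler_wpM2l (f0 _ Gx) fM1).
have n2 : 0 < nrm (f x) ^+ 2 by rewrite exprn_gt0.
rewrite -(ler_pM2r n2) -expr2; apply: le_trans h _.
by rewrite le_eqVlt; apply/orP; left; apply/eqP; ring.
Qed.

Lemma form_le_nrm f M x : nrm (f x) <= M * nrm x -> rip x (f x) <= M * nrm x ^+ 2.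
Proof.
move=> h; apply: le_trans (ler_norm _) _; apply: le_trans (cauchy_schwarz _ _) _.
by rewrite expr2 mulrCA ler_wpM2l ?nrm_ge0.
Qed.

(** Let m be the largest lower bound of the form on G. If m < m0, then f - m is nonnegative on G and
    bounded below by some c, and [psd_sq] gives c^2 |y|^2 <= |(f - m) y|^2 <= N <y, (f - m) y>; so m
    + c^2 / N would be a larger lower bound. *)
Lemma form_ge f G m0 : bop f -> rsub G -> (forall x, G x -> G (f x)) ->
  (forall m, m < m0 -> bounded_below_on G (shift f m)) ->
  forall x, G x -> m0 * nrm x ^+ 2 <= rip x (f x).
Proof.
move=> fb rG fG fm x Gx; case: (fb) => fl [M M0 fM] fs; rewrite leNgt; apply/negP => xlt.
pose A := [set m | forall y, G y -> m * nrm y ^+ 2 <= rip y (f y)].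
have AM : A (- M).
  move=> y Gy; have : `|rip y (f y)| <= M * nrm y ^+ 2.
    by apply: le_trans (cauchy_schwarz _ _) _; rewrite expr2 mulrCA ler_wpM2l ?nrm_ge0.
  by rewrite ler_norml => /andP[+ _]; rewrite mulNr.
have x0 : 0 < nrm x.
  by apply: nrm_gt0 => x0; move: xlt; rewrite x0 nrm0 rip0l expr0n mulr0 ltxx.
have x2 : 0 < nrm x ^+ 2 by rewrite exprn_gt0.
have Aub : ubound A (rip x (f x) / nrm x ^+ 2).
  by move=> m /(_ _ Gx); rewrite ler_pdivlMr.
have hA : has_sup A by split; [exists (- M)|exists (rip x (f x) / nrm x ^+ 2)].
set m := sup A.
have m_lt : m < m0.
  apply: le_lt_trans (_ : rip x (f x) / nrm x ^+ 2 < _).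
    by apply: sup_le_ub => //; exists (- M).
  by rewrite ltr_pdivrMr.
have Am : A m.
  move=> y Gy; have [->|y0] := pselect (y = 0).
    by rewrite nrm0 rip0l expr0n mulr0.
  have y2 : 0 < nrm y ^+ 2 by rewrite exprn_gt0 ?nrm_gt0.
  rewrite -ler_pdivlMr//; apply: sup_le_ub; first by exists (- M).
  by move=> n /(_ _ Gy); rewrite ler_pdivlMr.
have [c c0 Hc] := fm _ m_lt.
have [gl [N N0 gN] gs] := bop_shift m fb.
have g0 y : G y -> 0 <= rip y (shift f m y) <= N * nrm y ^+ 2.
  by move=> Gy; rewrite form_le_nrm// andbT; rewrite /shift !ripE ripxx subr_ge0; exact: Am.
have gG y : G y -> G (shift f m y).
  by move=> Gy; apply: rsubB => //; [exact: fG|exact: rsubZ].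
have Am' : A (m + c ^+ 2 / N).
  move=> y Gy; have := psd_sq gl gs rG g0 gG Gy.
  have : (c * nrm y) ^+ 2 <= nrm (shift f m y) ^+ 2.
    by rewrite ler_sqr ?nnegrE ?mulr_ge0 ?nrm_ge0 ?(ltW c0) ?Hc.
  move=> /le_trans /[apply]; rewrite -ler_pdivrMl// /shift !ripE ripxx => h.
  rewrite mulrDl -lerBrDl; apply: le_trans h.
  by rewrite le_eqVlt; apply/orP; left; apply/eqP; field; apply: lt0r_neq0.
have := sup_upper_bound hA Am'; rewrite -/m gerDl leNgt.
by rewrite divr_gt0 ?exprn_gt0.
Qed.

Lemma form_le f G m0 : bop f -> rsub G -> (forall x, G x -> G (f x)) ->
  (forall m, m0 < m -> bounded_below_on G (shift f m)) ->
  forall x, G x -> rip x (f x) <= m0 * nrm x ^+ 2.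
Proof.
move=> fb rG fG fm x Gx.
have := @form_ge (fun x => - f x) G (- m0) (bop_opp fb) rG _ _ x Gx.
rewrite ripNr mulNr lerN2; apply.
  by move=> y Gy; apply: rsubN => //; exact: fG.
move=> m; rewrite ltrNr => /fm[c c0 Hc]; exists c => // y Gy.
have -> : shift (fun x => - f x) m y = - shift f (- m) y; last by rewrite nrmN Hc.
by apply: rip_ext => w; rewrite /shift !ripE; ring.
Qed.

Lemma bounded_below_comp f g : bounded_below_on setT f -> bounded_below_on setT g ->
  bounded_below_on setT (f \o g).
Proof.
move=> [c c0 fc] [d d0 gd]; exists (c * d); first exact: mulr_gt0.
move=> x _ /=; apply: le_trans (fc _ I); rewrite -mulrA ler_wpM2l ?gd//; exact: ltW.
Qed.

Lemma coercive_bounded_below G f c : 0 < c -> (forall x, G x -> c * nrm x ^+ 2 <= rip x (f x)) ->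
  forall x, G x -> c * nrm x <= nrm (f x).
Proof.
move=> c0 fc x Gx; have [->|/nrm_gt0 x0] := pselect (x = 0).
  by rewrite nrm0 mulr0 nrm_ge0.
rewrite -(ler_pM2l x0) mulrCA -expr2; apply: le_trans (fc _ Gx) _.
exact: le_trans (ler_norm _) (cauchy_schwarz _ _).
Qed.

(** [form_ge] for the square (f - c)^2: if 0 <= m < rho^2 and q is the square root of m, then (f -
    c)^2 - m is the product of f - (c + q) and f - (c - q), both bounded below. *)
Lemma regular_gap f c rho : bop f -> 0 < rho ->
  (forall s, `|s - c| < rho -> reg f s) ->
  forall x, rho * nrm x <= nrm (shift f c x).
Proof.
move=> fb rho0 fr x; case: (fb) => fl _ _.
have gb := bop_shift c fb; have g2b := bop_sq gb.
have gs : rsym (shift f c) by case: gb.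
have := @form_ge _ setT (rho ^+ 2) g2b rsubT (fun _ _ => I) _ x I.
rewrite /= -gs ripxx -exprMn ler_sqr ?nnegrE ?mulr_ge0 ?nrm_ge0 ?(ltW rho0)//; apply.
move=> m m_lt; have [m0|m0] := ltP m 0.
  exists (- m); first by rewrite oppr_gt0.
  apply: coercive_bounded_below; first by rewrite oppr_gt0.
  move=> y _; rewrite /(shift (_ \o _)) ripDr ripNr ripZr /= -gs !ripxx.
  by rewrite mulNr -subr_ge0 opprK subrK sqr_ge0.
pose q := Num.sqrt m.
have q0 : 0 <= q by rewrite sqrtr_ge0.
have q2 : q ^+ 2 = m by rewrite sqr_sqrtr.
have q_lt : q < rho by rewrite -ltr_sqr ?nnegrE ?q2// ltW.
have -> : shift (shift f c \o shift f c) m = shift f (c + q) \o shift f (c - q).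
  apply/funext => y; apply: rip_ext => w; rewrite /shift /= -q2.
  by rewrite !(rlinB _ _ fl) !(rlinZ _ _ fl) !ripE; ring.
apply: bounded_below_comp; apply: fr.
  by rewrite addrC addKr ger0_norm.
by rewrite addrC addKr normrN ger0_norm.
Qed.

(** * Completeness and solvability of linear equations *)

Lemma expr_small (q C e : R) : 0 <= q < 1 -> 0 < e -> exists n, C * q ^+ n < e.
Proof.
move=> /andP[q0 q1] e0; have C0 : 0 < `|C| + 1 by rewrite ltr_wpDl.
have q1' : `|q| < 1 by rewrite ger0_norm.
have /cvgrPdist_lt/(_ _ (divr_gt0 e0 C0))[N _ HN] := cvg_expr q1'.
exists N; have := HN N (leqnn _); rewrite sub0r normrN ger0_norm ?exprn_ge0//.
rewrite ltr_pdivlMr// mulrC; apply: le_lt_trans.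
by rewrite ler_wpM2r ?exprn_ge0// (le_trans (ler_norm _))// lerDl.
Qed.

Lemma nrm_cauchy (u : nat -> H) :
  (forall e, 0 < e -> exists N, forall n m, (N <= n)%N -> (N <= m)%N -> nrm (u n - u m) < e) ->
  exists x, forall e, 0 < e -> exists N, forall n, (N <= n)%N -> nrm (x - u n) < e.
Proof.
move=> uC; have cu : cvgn u.
  apply/cauchy_cvgP/cauchy_ballP => e e0; near_simpl.
  have /RRe_real eE : e \is Num.real by rewrite realE ltW.
  have e0' : 0 < complex.Re e by rewrite -ltcR eE.
  have [N HN] := uC _ e0'; exists ([set n | N <= n]%N, [set n | N <= n]%N).
    by split; exists N.
  move=> [n m] [/= Nn Nm]; rewrite -ball_normE /= nrmE -eE ltcR.
  exact: HN.
exists (limn u) => e e0.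
have e0' : 0 < e%:C by rewrite ltcR.
have /cvgrPdist_lt/(_ _ e0')[N _ HN] := cu.
by exists N => n Nn; have := HN n Nn; rewrite /= nrmE ltcR.
Qed.

Lemma nrm_geometric (u : nat -> H) C q : 0 <= q < 1 ->
  (forall n, nrm (u n.+1 - u n) <= C * q ^+ n) ->
  exists x, forall e, 0 < e -> exists N, forall n, (N <= n)%N -> nrm (x - u n) < e.
Proof.
move=> q01 hu; apply: nrm_cauchy => e e0; case/andP: (q01) => q0 q1.
have C0 : 0 <= C by have := le_trans (nrm_ge0 _) (hu 0%N); rewrite expr0 mulr1.
pose D := C / (1 - q).
have D0 : 0 <= D by rewrite divr_ge0// subr_ge0 ltW.
have hD n k : nrm (u (n + k)%N - u n) <= D * (q ^+ n - q ^+ (n + k)).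
  elim: k => [|k IH]; first by rewrite addn0 !subrr nrm0 mulr0.
  have -> : u (n + k.+1)%N - u n = (u (n + k).+1 - u (n + k)%N) + (u (n + k)%N - u n).
    by rewrite addnS addrA subrK.
  apply: le_trans (nrmD _ _) _; apply: le_trans (lerD (hu _) IH) _.
  rewrite le_eqVlt; apply/orP; left; apply/eqP; rewrite addnS exprS /D.
  by field; rewrite subr_eq0 gt_eqF.
have [N HN] := expr_small (2 * D) q01 e0; exists N.
have hN n : (N <= n)%N -> nrm (u n - u N) <= D * q ^+ N.
  move=> Nn; rewrite -(subnKC Nn); apply: le_trans (hD _ _) _.
  by rewrite ler_wpM2l// gerBl exprn_ge0.
move=> n m Nn Nm; have -> : u n - u m = (u n - u N) - (u m - u N) by rewrite opprB addrA subrK.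
apply: le_lt_trans (nrmB _ _) _; apply: le_lt_trans HN.
by rewrite -mulrA mulr_natl mulr2n lerD// hN.
Qed.

Lemma nrm_small x : (forall e, 0 < e -> nrm x < e) -> x = 0.
Proof.
move=> xe; apply/eqP/negPn/negP => /eqP/nrm_gt0 x0.
by have := xe _ x0; rewrite ltxx.
Qed.

(* The solution is the limit of the iterates of the contraction
   x |-> x - tau (f x - b), which stay in G. *)
Lemma lax_milgram f G c b : rlin f -> bnd f -> rsub G -> (forall x, G x -> G (f x)) ->
  0 < c -> (forall x, G x -> c * nrm x ^+ 2 <= rip x (f x)) -> G b ->
  exists x, f x = b /\ forall e, 0 < e -> exists2 g, G g & nrm (x - g) < e.
Proof.
move=> fl [M0 M0_gt0 fM0] rG fG c0 fc Gb.
(* The contraction factor squared is at most 1 - 2 tau c + tau^2 M^2, minimal at tau = c / M^2 with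
   value 1 - c^2 / M^2; M is enlarged beyond c to keep this nonnegative. *)
have [M cM fM] : exists2 M, c < M & forall x, nrm (f x) <= M * nrm x.
  exists (M0 + c) => [|x]; first by rewrite ltrDr.
  by apply: le_trans (fM0 x) _; rewrite ler_wpM2r ?nrm_ge0// lerDl ltW.
have M_gt0 : 0 < M by apply: lt_trans cM.
have M2 : 0 < M ^+ 2 by rewrite exprn_gt0.
have [tau t0 tauE] : exists2 tau, 0 < tau & tau * M ^+ 2 = c.
  by exists (c / M ^+ 2); [exact: divr_gt0|rewrite divfK// lt0r_neq0].
have [u [Gu uS]] : exists u : nat -> H, (forall n, G (u n)) /\
    forall n, u n.+1 = u n - tau%:C *: (f (u n) - b).
  exists (fun n => iter n (fun x => x - tau%:C *: (f x - b)) 0); split=> // n.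
  elim: n => [|n IH] /=; first by case: rG.
  by apply: rsubB => //; apply: rsubZ => //; apply: rsubB => //; exact: fG.
pose q2 := 1 - tau * c.
have q2_ge0 : 0 <= q2.
  rewrite subr_ge0 -(ler_pM2r M2) mulrAC tauE mul1r -expr2.
  by rewrite ler_sqr ?nnegrE ltW.
have q2_lt1 : q2 < 1 by rewrite gtrBl mulr_gt0.
pose q := Num.sqrt q2.
have q01 : 0 <= q < 1.
  by rewrite sqrtr_ge0/= -[ltRHS]sqrtr1 ltr_sqrt.
have contr x : G x -> nrm (x - tau%:C *: f x) <= q * nrm x.
  move=> Gx; rewrite -ler_sqr ?nnegrE ?mulr_ge0 ?nrm_ge0 ?sqrtr_ge0//.
  rewrite exprMn sqr_sqrtr// -ripxx !ripE (ripC (f x)) !ripxx.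
  have h1 : nrm (f x) ^+ 2 <= M ^+ 2 * nrm x ^+ 2.
    by rewrite -exprMn ler_sqr ?nnegrE ?mulr_ge0 ?nrm_ge0 ?fM// ltW.
  have h2 := fc _ Gx.
  have h3 : tau ^+ 2 * nrm (f x) ^+ 2 <= tau ^+ 2 * (M ^+ 2 * nrm x ^+ 2).
    by rewrite ler_wpM2l ?sqr_ge0.
  have h4 : tau * (c * nrm x ^+ 2) <= tau * rip x (f x) by rewrite ler_wpM2l ?(ltW t0).
  have e1 : tau ^+ 2 * (M ^+ 2 * nrm x ^+ 2) = tau * (c * nrm x ^+ 2).
    by rewrite -tauE; ring.
  rewrite /q2; lra.
have hu n : nrm (u n.+1 - u n) <= nrm (u 1%N - u 0%N) * q ^+ n.
  elim: n => [|n IH]; first by rewrite expr0 mulr1.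
  have -> : u n.+2 - u n.+1 = (u n.+1 - u n) - tau%:C *: f (u n.+1 - u n).
    apply: rip_ext => w; rewrite (uS n.+1) (rlinB _ _ fl).
    have : rip (u n.+1) w = rip (u n) w - tau * (rip (f (u n)) w - rip b w).
      by rewrite uS !ripE.
    by move=> h; rewrite !ripE; lra.
  apply: le_trans (contr _ _) _; first exact: rsubB.
  by rewrite exprS mulrCA ler_wpM2l ?sqrtr_ge0.
have [x xu] := nrm_geometric q01 hu; exists x; split; last first.
  by move=> e e0; have [N HN] := xu _ e0; exists (u N) => //; exact: HN.
apply/subr0_eq/nrm_small => e e0.
have K0 : 0 < M + 2 / tau by rewrite addr_gt0// divr_gt0.
have [N HN] := xu _ (divr_gt0 e0 K0).
have h1 := HN N (leqnn _); have h2 := HN N.+1 (leqnSn _).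
(* By the iteration, f (u N) - b is (u N - u (N + 1)) / tau. *)
have -> : f x - b = f (x - u N) + (tau^-1)%:C *: ((x - u N.+1) - (x - u N)).
  apply: rip_ext => w; rewrite uS (rlinB _ _ fl) !ripE; field.
  exact: lt0r_neq0.
apply: le_lt_trans (nrmD _ _) _; rewrite nrmZ ger0_norm ?invr_ge0 ?(ltW t0)//.
have h3 := fM (x - u N); have h4 := nrmB (x - u N.+1) (x - u N).
have h5 : tau^-1 * nrm (x - u N.+1 - (x - u N)) < tau^-1 * (2 * (e / (M + 2 / tau))).
  rewrite ltr_pM2l ?invr_gt0//; lra.
have h6 : M * nrm (x - u N) < M * (e / (M + 2 / tau)) by rewrite ltr_pM2l.
have e1 : M * (e / (M + 2 / tau)) + tau^-1 * (2 * (e / (M + 2 / tau))) = e.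
  by field; rewrite !lt0r_neq0// addr_gt0// mulr_gt0.
lra.
Qed.

(** The product N N' is coercive, as <x, N N' x> = |N' x|^2, so N (N' x) = b is solvable. *)
Lemma onto_of_adjoint N N' : rlin N -> bnd N -> rlin N' -> bnd N' ->
  (forall x y, rip (N x) y = rip x (N' y)) -> bounded_below_on setT N' ->
  forall b, exists x, N x = b.
Proof.
move=> Nl Nb N'l N'b adj [c c0 Nc] b.
have [||x _|x [fx _]] := @lax_milgram (N \o N') setT (c ^+ 2) b (rlin_comp Nl N'l)
   (bnd_comp Nb N'b) rsubT _ _ _ I; last by exists (N' x).
- by [].
- by rewrite exprn_gt0.
by rewrite /= ripC adj ripxx -exprMn ler_sqr ?nnegrE ?mulr_ge0 ?nrm_ge0 ?(ltW c0)// Nc.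
Qed.

Lemma bop_onto f : bop f -> bounded_below_on setT f -> forall b, exists x, f x = b.
Proof. by move=> [fl fb fs] fc; exact: (onto_of_adjoint fl fb fl fb fs fc). Qed.

(** * Isolated points of the spectrum *)

Definition ker (f : H -> H) (x : H) := f x = 0.
Definition perp (G : set H) : set H := [set x | forall y, G y -> rip x y = 0].

Lemma rsub_perp G : rsub (perp G).
Proof.
split; first by move=> y _; rewrite rip0l.
by move=> a x y xG yG z Gz; rewrite !ripE xG// yG// mulr0 addr0.
Qed.

(* If 0 is isolated in the spectrum of X, then applying [regular_gap] on both
   sides of 0 gives |<x, X x>| <= |X x|^2 / 2r; polarizing, |X x| <= |X^2 x| / 2r,
   so X is bounded below on its range, which is dense in the complement of its kernel. *)
Lemma isolated_bounded_below_perp_ker X (r : R) : bop X -> 0 < r ->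
  (forall s : R, s != 0 -> `|s| < 2 * r -> reg X s) -> bounded_below_on (perp (ker X)) X.
Proof.
move=> Xb r0 Xr; case: (Xb) => Xl Xbd Xs.
have side c : `|c| = r -> forall x, 2 * c * rip x (X x) <= nrm (X x) ^+ 2.
  move=> cr x; have := @regular_gap X c r Xb r0 _ x.
  have h : forall s, `|s - c| < r -> reg X s.
    move=> s sc; apply: Xr.
      by apply/eqP => s0; move: sc; rewrite s0 sub0r normrN cr ltxx.
    rewrite -(subrK c s); apply: le_lt_trans (ler_normD _ _) _; rewrite cr; lra.
  move=> /(_ h); rewrite -ler_sqr ?nnegrE ?mulr_ge0 ?nrm_ge0 ?(ltW r0)//.
  rewrite exprMn -[nrm (shift _ _ _) ^+ 2]ripxx /shift !ripE (ripC (X x)) !ripxx.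
  have cc : c * c = r ^+ 2 by rewrite -cr -expr2 real_normK ?num_real.
  by rewrite -cc; lra.
have form x : `|rip x (X x)| * (2 * r) <= nrm (X x) ^+ 2.
  have h1 := side r (gtr0_norm r0) x.
  have := side (- r) _ x; rewrite normrN => /(_ (gtr0_norm r0)) h2.
  by case: (ler0P (rip x (X x))) => _; lra.
have rng w : 2 * r * nrm (X w) <= nrm (X (X w)).
  have pol x y : 4 * rip x (X y) = rip (x + y) (X (x + y)) - rip (x - y) (X (x - y)).
    by rewrite (rlinB _ _ Xl) (rlinD _ _ Xl) !ripE -(Xs y x) (ripC (X y)); ring.
  (* The polarization is taken at the pair w, t X w; the resulting inequality is quadratic in t, and
     its discriminant gives the bound. *)
  have bil t : 4 * t * rip w (X (X w)) * (2 * r) <=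
      2 * (nrm (X w) ^+ 2 + t ^+ 2 * nrm (X (X w)) ^+ 2).
    have h1 := form (w + t%:C *: X w); have h2 := form (w - t%:C *: X w).
    have := pol w (t%:C *: X w); rewrite (rlinZ _ _ Xl) ripZr => p.
    have a1 := ler_norm (rip (w + t%:C *: X w) (X (w + t%:C *: X w))).
    have a2 := ler_norm (- rip (w - t%:C *: X w) (X (w - t%:C *: X w))); rewrite normrN in a2.
    have hA : 4 * t * rip w (X (X w)) <= `|rip (w + t%:C *: X w) (X (w + t%:C *: X w))| +
        `|rip (w - t%:C *: X w) (X (w - t%:C *: X w))|.
      by rewrite -mulrA p; lra.
    have r20 : 0 <= 2 * r by lra.
    have hA2 := ler_wpM2r r20 hA; rewrite [leRHS]mulrDl in hA2.
    apply: le_trans hA2 _; apply: le_trans (lerD h1 h2) _.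
    rewrite -!ripxx (rlinB _ _ Xl) (rlinD _ _ Xl) (rlinZ _ _ Xl) !ripE.
    by rewrite (ripC (X (X w)) (X w)) le_eqVlt; apply/orP; left; apply/eqP; ring.
  rewrite -Xs ripxx in bil.
  set a := nrm (X w) in bil *; set b := nrm (X (X w)) in bil *.
  have a0 : 0 <= a := nrm_ge0 _; have b0 : 0 <= b := nrm_ge0 _.
  have disc : (- (2 * (2 * r) * a ^+ 2 / 2)) ^+ 2 <= a ^+ 2 * b ^+ 2.
    apply: discr_le => s t; have [->|s0] := eqVneq s 0.
      by apply: le_trans (sqr_ge0 (t * b)) _; rewrite le_eqVlt; apply/orP; left; apply/eqP; ring.
    have := bil (t / s); have s2 : 0 < s ^+ 2 by rewrite exprn_even_gt0.
    rewrite -(ler_pM2r s2).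
    have -> : 4 * (t / s) * a ^+ 2 * (2 * r) * s ^+ 2 = 8 * r * s * t * a ^+ 2 by field.
    have -> : 2 * (a ^+ 2 + (t / s) ^+ 2 * b ^+ 2) * s ^+ 2 =
      2 * (s ^+ 2 * a ^+ 2 + t ^+ 2 * b ^+ 2) by field.
    lra.
  have {}disc : (2 * r * a) ^+ 2 * a ^+ 2 <= b ^+ 2 * a ^+ 2.
    apply: le_trans (_ : (- (2 * (2 * r) * a ^+ 2 / 2)) ^+ 2 <= _); last by rewrite [leRHS]mulrC.
    by rewrite le_eqVlt; apply/orP; left; apply/eqP; field.
  have [a_eq0|a_neq0] := eqVneq a 0; first by rewrite a_eq0 mulr0.
  have a2 : 0 < a ^+ 2 by rewrite exprn_even_gt0.
  by move: disc; rewrite ler_pM2r// ler_sqr ?nnegrE ?mulr_ge0// ltW.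
pose G : set H := range X.
have rG : rsub G.
  split; first by exists 0 => //; exact: rlin0.
  by move=> a _ _ [x _ <-] [y _ <-]; exists (a%:C *: x + y) => //; rewrite Xl.
have X2l := rlin_comp Xl Xl; have X2b := bnd_comp Xbd Xbd.
exists (2 * r); first lra.
move=> e eK; have r2 : 0 < (2 * r) ^+ 2 by rewrite exprn_gt0//; lra.
(* Solving X^2 x = X^2 e in the closure of the range recovers e: the difference x - e lies in Ker X
   and is orthogonal to it. So e is a limit of elements of the range, and the bound passes to the
   limit. *)
have [|||x [Xx xG]] := @lax_milgram (X \o X) G ((2 * r) ^+ 2) (X (X e)) X2l X2b rG _ r2 _ _.
- by move=> x _; exists (X x).
- move=> _ [x _ <-]; rewrite /= -Xs ripxx -exprMn.
  by rewrite ler_sqr ?nnegrE ?mulr_ge0 ?nrm_ge0 ?rng ?(ltW r0).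
- by exists (X e).
have Xd : X (x - e) = 0.
  apply: nrm_eq0; apply/eqP; rewrite eq_le nrm_ge0 andbT.
  have := rng (x - e); rewrite (rlinB _ _ Xl) (rlinB _ _ Xl) [X (X x)]Xx subrr nrm0.
  by rewrite pmulr_rle0//; lra.
have xK : perp (ker X) x.
  move=> y Xy; apply/eqP/negPn/negP => /eqP xy.
  have y0 : 0 < nrm y.
    by apply: nrm_gt0 => y0; apply: xy; rewrite y0 rip0r.
  have xy0 : 0 < `|rip x y| / nrm y by rewrite divr_gt0// normr_gt0; apply/eqP.
  have [_ [z _ <-] /[!ltr_pdivlMr]//] := xG _ xy0.
  apply/negP; rewrite -leNgt; apply: le_trans (cauchy_schwarz _ _).
  by rewrite !ripE Xs Xy rip0r subr0.
have xe : x = e.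
  apply/subr0_eq/nrm_eq0/eqP; rewrite -sqrf_eq0 -ripxx; apply/eqP.
  by apply: (rsubB (rsub_perp _) xK eK).
have [M M0 XM] := Xbd.
apply/ler_addgt0Pr => eps eps0; have K0 : 0 < M + 2 * r by lra.
have [_ [z _ <-] zx] := xG _ (divr_gt0 eps0 K0); rewrite xe ltr_pdivlMr// in zx.
have h1 := rng z; have h2 := XM (e - X z).
have h3 := nrmD (e - X z) (X z); rewrite subrK in h3.
have h4 := nrmB (X e) (X (e - X z)); rewrite (rlinB _ _ Xl) subKr in h4.
rewrite (rlinB _ _ Xl) in h2 h4.
have : 2 * r * nrm e <= 2 * r * (nrm (e - X z) + nrm (X z)) by rewrite ler_pM2l//; lra.
lra.
Qed.

(** * Resolvents of symmetric operators *)

Lemma continuous_bnd (f : {linear H -> H}) : continuous f -> bnd f.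
Proof.
move=> /linear_bounded_continuous/linear_boundedP/pinfty_ex_gt0[r r0 fr].
have /RRe_real rE : r \is Num.real by rewrite realE ltW.
exists (complex.Re r); first by rewrite -ltcR rE.
by move=> x; rewrite -lecR rmorphM/= rE -!nrmE.
Qed.

Lemma bnd_continuous (f : {linear H -> H}) : bnd f -> continuous f.
Proof.
move=> [M M0 fM]; apply: bounded_linear_continuous; apply/linear_boundedP.
near=> r => x; apply: le_trans (_ : M%:C * `|x| <= _).
  by rewrite !nrmE -rmorphM lecR.
rewrite ler_wpM2r//; near: r; apply: nbhs_pinfty_ge.
by apply/complex_realP; exists M.
Unshelve. all: by end_near. Qed.

Lemma linear_inverse (f : H -> H) : linear f -> (forall b, exists x, f x = b) ->
  bounded_below_on setT f ->
  exists g : {linear H -> H}, [/\ bnd g, forall x, f (g x) = x & forall x, g (f x) = x].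
Proof.
move=> fl fonto [c c0 fc].
have finj x y : f x = f y -> x = y.
  move=> fxy; apply/subr0_eq/nrm_eq0/eqP; rewrite eq_le nrm_ge0 andbT.
  have f0 : f (x - y) = 0.
    by have -> : x - y = (-1) *: y + x; rewrite ?fl ?fxy scaleN1r ?addNr// addrC.
  by have := fc (x - y) I; rewrite f0 nrm0 pmulr_rle0.
have [g fg] := choice fonto.
have gl : linear g by move=> a x y; apply: finj; rewrite fl !fg.
pose gL : {linear H -> H} := HB.pack g (GRing.isLinear.Build _ _ _ _ g gl).
exists gL; split=> //; last by move=> x; apply: finj; rewrite fg.
exists c^-1; first by rewrite invr_gt0.
by move=> x; rewrite ler_pdivlMl//; have := fc (g x) I; rewrite fg.
Qed.

Definition is_res (T : operator H) (g : R) (S : {linear H -> H}) :=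
  [/\ continuous S, forall y, op_dom T (S y) /\ T (S y) - g%:C *: S y = y
    & forall x, op_dom T x -> S (T x - g%:C *: x) = x].

Definition sym_op (T : operator H) :=
  forall x y, op_dom T x -> op_dom T y -> ip (T x) y = ip x (T y).

Lemma self_adjoint_sym T : self_adjoint ip T -> sym_op T.
Proof.
by move=> [_ Tsa] x y Tx Ty; have [_ h] := Tsa y (T y); exact: h.
Qed.

Lemma op_add_sym T (B : {linear H -> H}) : sym_op T -> symmetric_op ip B ->
  sym_op (op_add T B).
Proof. by move=> Ts Bs x y Tx Ty /=; rewrite linearDl linearD /= Ts// Bs. Qed.

Lemma res_dom T (g : R) (S : {linear H -> H}) (TS : is_res T g S) y :
  op_dom T (S y).
Proof. by case: TS => _ /(_ y)[]. Qed.

Lemma resE T (g : R) (S : {linear H -> H}) (TS : is_res T g S) y : T (S y) = y + g%:C *: S y.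
Proof. by case: TS => _ /(_ y)[_ h] _; rewrite -{2}h subrK. Qed.

Lemma resK T (g : R) (S : {linear H -> H}) (TS : is_res T g S) x :
  op_dom T x -> S (T x - g%:C *: x) = x.
Proof. by case: TS => _ _; exact. Qed.

Lemma res_inj T (g : R) (S : {linear H -> H}) (TS : is_res T g S) x : S x = 0 -> x = 0.
Proof.
move=> Sx; have := resE TS x; rewrite Sx scaler0 addr0 => <-.
have := @op_linear _ _ T (-1) 0 0 (op_dom0 T) (op_dom0 T).
by rewrite !scaleN1r oppr0 addr0 addNr.
Qed.

Lemma res_ip_sym T (g : R) (S : {linear H -> H}) (Tsym : sym_op T) (TS : is_res T g S) x y :
  ip (S x) y = ip x (S y).
Proof.
have h := Tsym _ _ (res_dom TS x) (res_dom TS y).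
move: h; rewrite !(resE TS) linearDl linearD /= linearZl_LR linearZ_LR /= conj_real.
by move/addIr => ->.
Qed.

Lemma res_bop T (g : R) (S : {linear H -> H}) (Tsym : sym_op T) (TS : is_res T g S) : bop S.
Proof.
split; [exact: linear_rlin|by apply: continuous_bnd; case: TS|].
by move=> x y; rewrite /rip (res_ip_sym Tsym TS).
Qed.

(** With nu = 1 / (l - g) one has T - l = -(l - g) (S - nu) (T - g), so the resolvent at l is -nu S
    (S - nu)^-1. All spectral information on T is thereby read off from lower bounds for S - nu. *)
Lemma res_reg T (g : R) (S : {linear H -> H}) (Tsym : sym_op T) (TS : is_res T g S) l :
  l != g -> resolvent_set T l%:C <-> reg S (l - g)^-1.
Proof.
move=> lg; have lg0 : l - g != 0 by rewrite subr_eq0.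
have [Sl Sb Ss] := res_bop Tsym TS; split.
  move=> [Sl' [Sc' S1 S2]]; have [M M0 SM] := continuous_bnd Sc'.
  have K0 : 0 < 1 + `|l - g| * M by rewrite ltr_pwDl// mulr_ge0 ?(ltW M0).
  exists (`|l - g|^-1 / (1 + `|l - g| * M)).
    by rewrite divr_gt0// invr_gt0 normr_gt0.
  move=> x _; pose n := x - (l - g)%:C *: S x.
  have nE : n = T (S x) - l%:C *: S x.
    by apply: rip_ext => w; rewrite (resE TS) /n !ripE; ring.
  have Sx : S x = Sl' n by rewrite nE S2//; exact: res_dom TS _.
  have -> : shift S (l - g)^-1 x = ((- (l - g))^-1)%:C *: n.
    by apply: rip_ext => w; rewrite /shift /n !ripE; field.
  rewrite nrmZ normfV normrN -mulrA ler_pM2l ?invr_gt0 ?normr_gt0//.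
  rewrite ler_pdivrMl// mulrDl mul1r.
  have {1}-> : x = n + (l - g)%:C *: Sl' n by rewrite -Sx subrK.
  apply: le_trans (nrmD _ _) _; rewrite lerD2l nrmZ -mulrA.
  by rewrite ler_wpM2l.
move=> rS; have Xb := bop_shift (l - g)^-1 (res_bop Tsym TS).
have Xl : linear (shift S (l - g)^-1).
  move=> a x y; rewrite /shift linearP !scalerDr !scalerA mulrC -scalerA.
  by rewrite opprD addrACA scalerN.
have [K [Kb K1 K2]] := linear_inverse Xl (bop_onto Xb rS) rS.
pose nu := (l - g)^-1.
pose L : {linear H -> H} := (- nu)%:C \*: (S \o K).
have LE x : L x = (- nu)%:C *: S (K x) by [].
have KS x : shift S nu (S x) = S (shift S nu x).
  by rewrite /shift (rlinB _ _ Sl) (rlinZ _ _ Sl).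
have SK x : S (K x) = K (S x).
  by rewrite -{2}(K1 x) -KS K2.
have nuE : nu * (l - g) = 1 by rewrite mulVf.
have nuK p : (l - g) * (nu * p) = p by rewrite mulrA [_ * nu]mulrC nuE mul1r.
exists L; split.
- apply: bnd_continuous; have [M M0 KM] := bnd_comp Sb Kb.
  exists (`|nu| * M + 1); first by rewrite ltr_wpDl// mulr_ge0 ?(ltW M0).
  move=> x; rewrite LE nrmZ normrN; apply: le_trans (_ : (`|nu| * M) * nrm x <= _).
    by rewrite -mulrA ler_wpM2l ?normr_ge0 ?KM.
  by rewrite ler_wpM2r ?nrm_ge0// lerDl.
- move=> y; rewrite LE -(rlinZ _ _ Sl); split; first exact: res_dom TS _.
  rewrite (resE TS); set w := _ *: K y.
  have yE : y = (- (l - g))%:C *: shift S nu w.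
    rewrite /w; apply: rip_ext => v; rewrite /shift (rlinZ _ _ Sl) !ripE.
    have := K1 y; rewrite /shift -/nu => {1}<-; rewrite !ripE.
    have -> : forall p, - (l - g) * (- nu * rip (S (K y)) v - nu * (- nu * p))
      = (nu * (l - g)) * (rip (S (K y)) v - nu * p) by move=> p; ring.
    by rewrite nuE mul1r.
  rewrite [RHS]yE; move: w {yE} => w; apply: rip_ext => v; rewrite /shift !ripE.
  have := nuK (rip w v); lra.
- move=> x Tx; rewrite LE SK -(rlinZ _ _ (linear_rlin K)).
  have -> : S (T x - l%:C *: x) = (- (l - g))%:C *: shift S nu x.
    have -> : T x - l%:C *: x = (T x - g%:C *: x) - (l - g)%:C *: x.
      by apply: rip_ext => v; rewrite !ripE; ring.
    rewrite (rlinB _ _ Sl) (resK TS)// (rlinZ _ _ Sl); apply: rip_ext => v; rewrite /shift !ripE.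
    have := nuK (rip x v); lra.
  rewrite scalerA -rmorphM/= mulrNN nuE scale1r; exact: K2.
Qed.

Lemma res_regular_near T (g : R) (S : {linear H -> H}) (Tsym : sym_op T) (TS : is_res T g S) :
  exists2 c, 0 < c & forall l, `|l - g| < c -> resolvent_set T l%:C.
Proof.
have [_ [M M0 SM] _] := res_bop Tsym TS; exists M^-1; first by rewrite invr_gt0.
move=> l lg; have [->|l_neq_g] := eqVneq l g; first by exists S; case: TS.
apply/(res_reg Tsym TS) => //; have lg0 : 0 < `|l - g| by rewrite normr_gt0 subr_eq0.
exists (`|l - g|^-1 - M).
  by rewrite subr_gt0 -ltf_pV2 ?posrE ?invr_gt0// invrK.
move=> x _; rewrite mulrBl lerBlDr.
have -> : `|l - g|^-1 * nrm x = nrm (((l - g)^-1)%:C *: x) by rewrite nrmZ normfV.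
have {1}-> : ((l - g)^-1)%:C *: x = S x - shift S (l - g)^-1 x by rewrite /shift subKr.
by apply: le_trans (nrmB _ _) _; rewrite addrC lerD2l.
Qed.

(** A value m < -1/d corresponds to the point g + 1/m between g - d and g, which is regular;
    [form_ge] applies. *)
Lemma res_lower T (g : R) (S : {linear H -> H}) (Tsym : sym_op T) (TS : is_res T g S) d :
  0 < d -> (forall l, g - d < l -> l <= g -> ~ spectrum T l) ->
  forall x, - d^-1 * nrm x ^+ 2 <= rip x (S x).
Proof.
move=> d0 sp x; apply: (form_ge (res_bop Tsym TS) rsubT) => // m md.
have m0 : m < 0 by apply: lt_trans md _; rewrite oppr_lt0 invr_gt0.
have mV : m^-1 < 0 by rewrite invr_lt0.
have /(res_reg Tsym TS) : g + m^-1 != g by rewrite -subr_eq0 addrC addKr lt_eqF.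
rewrite addrC addrK invrK => -[+ _]; apply.
apply/not_notP; apply: sp; last by rewrite gerDr ltW.
rewrite [_ + g]addrC ltrD2l -[m^-1]opprK ltrN2 -invrN -[d]invrK ltf_pV2 ?posrE ?invr_gt0//.
  by rewrite ltrNr.
by rewrite oppr_gt0.
Qed.

(** The second resolvent identity. *)
Lemma res_add_id T (W : {linear H -> H}) (g : R) S S1 : is_res T g S -> is_res (op_add T W) g S1 ->
  forall x, S1 x + S (W (S1 x)) = S x.
Proof.
move=> TS TS1 x; have := resE TS1 x => /= h.
have d1 : op_dom T (S1 x) := res_dom TS1 x.
rewrite -{1}(resK TS d1) -linearD; congr (S _).
by rewrite addrAC h addrK.
Qed.

Lemma one_plus_bnd h : bnd h -> bnd (fun x => x + h x).
Proof.
move=> [m m0 hm]; exists (1 + m); first by rewrite addr_gt0.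
by move=> x; apply: le_trans (nrmD _ _) _; rewrite mulrDl mul1r lerD2l.
Qed.

Lemma one_plus_rlin h : rlin h -> rlin (fun x => x + h x).
Proof. by move=> hl a x y; rewrite hl scalerDr addrACA. Qed.

(** Pairing y + S W y with W y gives at least <y, W y> - theta |W y|^2 >= (1 / beta - theta) |W
    y|^2, which bounds W y; then y = (y + S W y) - S (W y) is bounded as well. The second claim is
    the same bound at S y. Only the lower bound of S enters the smallness condition, not its
    norm. *)
Lemma one_plus_bounded_below S W (theta beta : R) :
  bop S -> bop W -> 0 < beta -> theta * beta < 1 ->
  (forall x, 0 <= rip x (W x) <= beta * nrm x ^+ 2) ->
  (forall x, - theta * nrm x ^+ 2 <= rip x (S x)) ->
  bounded_below_on setT (fun x => x + S (W x)) /\ bounded_below_on setT (fun x => x + W (S x)).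
Proof.
move=> [Sl Sb Ss] [Wl Wb Wsym] b0 tb W0 Sth.
have Wsq x : nrm (W x) ^+ 2 <= beta * rip x (W x).
  by apply: (psd_sq Wl Wsym rsubT) => //.
pose C := beta / (1 - theta * beta).
have tb0 : 0 < 1 - theta * beta by rewrite subr_gt0.
have C0 : 0 < C by rewrite divr_gt0.
have ap y : nrm (W y) <= C * nrm (y + S (W y)).
  have [->|/nrm_gt0 Wy0] := pselect (W y = 0); first by rewrite nrm0 mulr_ge0 ?nrm_ge0 ?ltW.
  rewrite /C mulrAC ler_pdivlMr// -(ler_pM2r Wy0).
  have h1 := le_trans (ler_norm _) (cauchy_schwarz (y + S (W y)) (W y)).
  have h2 := Sth (W y); have h3 := Wsq y; rewrite ripDl (ripC (S (W y))) in h1.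
  have [th0|th0] := leP 0 theta.
    have h4 : theta * nrm (W y) ^+ 2 <= theta * (beta * rip y (W y)) by rewrite ler_wpM2l.
    have h5 : beta * (rip y (W y) * (1 - theta * beta)) <= beta * (nrm (y + S (W y)) * nrm (W y)).
      by rewrite ler_pM2l//; lra.
    have h6 : (1 - theta * beta) * nrm (W y) ^+ 2 <= (1 - theta * beta) * (beta * rip y (W y)).
      by rewrite ler_pM2l.
    lra.
  have h5 : beta * (rip y (W y) - theta * nrm (W y) ^+ 2) <= beta * (nrm (y + S (W y)) * nrm (W y)).
    by rewrite ler_pM2l//; lra.
  lra.
move: C C0 ap => C C0 ap.
have [M M0 SM] := Sb; split.
  have K0 : 0 < 1 + M * C by rewrite addr_gt0// mulr_gt0.
  exists (1 + M * C)^-1; first by rewrite invr_gt0.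
  move=> y _; rewrite ler_pdivrMl// mulrDl mul1r.
  have {1}-> : y = (y + S (W y)) - S (W y) by rewrite addrK.
  apply: le_trans (nrmB _ _) _; rewrite lerD2l; apply: le_trans (SM _) _.
  by rewrite -mulrA ler_pM2l.
have K0 : 0 < 1 + C * M by rewrite addr_gt0// mulr_gt0.
exists (1 + C * M)^-1; first by rewrite invr_gt0.
move=> y _; rewrite ler_pdivrMl// mulrDl mul1r.
have {1}-> : y = (y + W (S y)) - W (S y) by rewrite addrK.
apply: le_trans (nrmB _ _) _; rewrite lerD2l; apply: le_trans (ap _) _.
by rewrite -(rlinD _ _ Sl) -mulrA ler_wpM2l ?(ltW C0).
Qed.

(** The resolvent is (1 + S W)^-1 S; lower bounds for 1 + S W and for its adjoint 1 + W S make 1 + S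
    W invertible. *)
Lemma res_add T (W : {linear H -> H}) (g : R) S (theta beta : R) : sym_op T -> is_res T g S ->
  bop W -> 0 < beta -> theta * beta < 1 ->
  (forall x, 0 <= rip x (W x) <= beta * nrm x ^+ 2) ->
  (forall x, - theta * nrm x ^+ 2 <= rip x (S x)) ->
  exists S1, is_res (op_add T W) g S1.
Proof.
move=> Ts TS Wbop b0 tb W0 Sth; have Sbop := res_bop Ts TS.
have [fblow f'blow] := one_plus_bounded_below Sbop Wbop b0 tb W0 Sth.
case: Sbop Wbop => Sl Sb Ss [Wl Wb Wsym].
have fl : linear (fun x => x + S (W x)).
  by move=> a x y; rewrite !linearP scalerDr addrACA.
have adj x y : rip (x + S (W x)) y = rip x (y + W (S y)).
  by rewrite ripDl ripDr Ss Wsym.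
have onto := onto_of_adjoint (one_plus_rlin (rlin_comp Sl Wl)) (one_plus_bnd (bnd_comp Sb Wb))
  (one_plus_rlin (rlin_comp Wl Sl)) (one_plus_bnd (bnd_comp Wb Sb)) adj f'blow.
have [F [Fb F1 F2]] := linear_inverse fl onto fblow.
exists (F \o S : {linear H -> H}); split.
- by apply: bnd_continuous; exact: bnd_comp.
- move=> x /=; move: (F (S x)) (F1 (S x)) => y yE.
  have yS : y = S (x - W y) by rewrite (rlinB _ _ Sl) -yE addrK.
  split; first by rewrite yS; exact: res_dom TS _.
  have -> : T y = x - W y + g%:C *: y by rewrite {1}yS (resE TS) -yS.
  apply: rip_ext => v; rewrite !ripE; ring.
move=> x /= Tx; rewrite -[RHS]F2; congr (F _).
by rewrite addrAC linearD/= (resK TS).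
Qed.

(* With y = SB x and u = SC x - y one has u = SA z for z = (B - C) y - C u, and
   <x, u> = <y, (B - C) y> + <u, C u> + <z, SA z>, where the first two terms
   dominate |z|^2 / beta because (B - C) + C = B <= beta. *)
Lemma res_monotone SA SB SC (B C : {linear H -> H}) (beta theta : R) :
  bop SA -> rsym B -> rsym C -> 0 < beta -> 0 < theta -> theta * beta <= 1 ->
  (forall x, 0 <= rip x (C x)) -> (forall x, rip x (C x) <= rip x (B x)) ->
  (forall x, rip x (B x) <= beta * nrm x ^+ 2) ->
  (forall x, - theta * nrm x ^+ 2 <= rip x (SA x)) ->
  (forall x, SB x + SA (B (SB x)) = SA x) -> (forall x, SC x + SA (C (SC x)) = SA x) ->
  forall x, rip x (SB x) <= rip x (SC x).
Proof.
move=> [Sl Sb Ss] Bs Cs b0 th0 tb C0 CB Bb Sth SBE SCE x.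
have Bl := linear_rlin B; have Cl := linear_rlin C.
have [y yE] : exists y, y = SB x by exists (SB x).
have [u SCx] : exists u, SC x = y + u by exists (SC x - y); rewrite addrC subrK.
have [z zE] : exists z, z = B y - C y - C u by exists (B y - C y - C u).
have SBx := SBE x; rewrite -yE in SBx *.
have uE : u = SA z.
  have := SCE x; rewrite SCx -SBx zE !(rlinB _ _ Sl) (rlinD _ _ Cl) (rlinD _ _ Sl) => h.
  apply: rip_ext => w; have /(congr1 (fun v => rip v w)) := h.
  by rewrite !ripE; lra.
rewrite -subr_ge0 -ripNr -ripDr SCx addrAC subrr add0r.
have xu : rip x u = (rip y (B y) - rip y (C y)) + rip u (C u) + rip z (SA z).
  have e1 : rip z (SA z) = rip (B y) u - rip (C y) u - rip (C u) u by rewrite -uE zE !ripE.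
  have e2 : rip y z = rip y (B y) - rip y (C y) - rip y (C u) by rewrite zE !ripE.
  have e3 : rip x u = rip y z + rip (B y) u by rewrite {1}uE -Ss -SBx ripDl Ss -uE.
  rewrite e3 e1 e2 (ripC (C u) u) (Cs y u); lra.
have zsq : nrm z ^+ 2 <= beta * ((rip y (B y) - rip y (C y)) + rip u (C u)).
  (* The form of B - C at s z + t y and that of C at s z - t u are added: as z = (B - C) y - C u,
     the mixed coefficient is |z|^2. *)
  have : rip z z ^+ 2 <= rip z (B z) * ((rip y (B y) - rip y (C y)) + rip u (C u)).
    apply: discr_le => s t.
    have h1 := CB (s%:C *: z + t%:C *: y); have h2 := C0 (s%:C *: z - t%:C *: u).
    have e1 : rip z z = rip z (B y) - rip z (C y) - rip z (C u) by rewrite {2}zE !ripE.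
    move: h1 h2; rewrite e1.
    rewrite !(rlinD _ _ Bl, rlinD _ _ Cl, rlinN _ Cl, rlinZ _ _ Bl, rlinZ _ _ Cl) !ripE.
    by rewrite -(Bs y z) -(Cs y z) -(Cs u z) (ripC (B y)) (ripC (C y)) (ripC (C u)) => h1 h2; lra.
  have [->|/nrm_gt0 z0] := pselect (z = 0).
    by rewrite nrm0 expr0n mulr_ge0 ?(ltW b0)// addr_ge0// subr_ge0.
  have z2 : 0 < nrm z ^+ 2 by rewrite exprn_gt0.
  set D := _ + _; have D0 : 0 <= D by rewrite addr_ge0// subr_ge0.
  rewrite ripxx => h; rewrite -(ler_pM2r z2) -expr2; apply: le_trans h _.
  by rewrite mulrAC ler_wpM2r.
have h1 := Sth z; rewrite xu.
have h2 : theta * nrm z ^+ 2 <= theta * (beta * ((rip y (B y) - rip y (C y)) + rip u (C u))).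
  by rewrite ler_pM2l.
have h3 : 0 <= (rip y (B y) - rip y (C y)) + rip u (C u) by rewrite addr_ge0// subr_ge0.
have h4 := ler_wpM2r h3 tb; lra.
Qed.

(** * Finite-dimensional subspaces *)

Lemma nontrivial_kernel (m n : nat) (M : nat -> nat -> R[i]) : (m < n)%N ->
  exists c : nat -> R[i], (exists2 i, (i < n)%N & c i != 0) /\
    forall j, (j < m)%N -> \sum_(i < n) c i * M i j = 0.
Proof.
move=> mn; pose A := \matrix_(i < n, j < m) M i j.
have : kermx A != 0.
  by rewrite -mxrank_eq0 mxrank_ker subn_eq0 -ltnNge (leq_ltn_trans (rank_leq_col _)).
move=> /rowV0Pn[u /sub_kermxP uA u0].
have n0 : (0 < n)%N by apply: leq_ltn_trans mn.
pose c k := if insub k is Some i then u 0 i else 0.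
have cE (i : 'I_n) : c i = u 0 i by rewrite /c valK.
exists c; split.
  have /rV0Pn[i ui] := u0; exists i => //; by rewrite cE.
move=> j jm; have /rowP/(_ (Ordinal jm)) := uA; rewrite !mxE => h.
by rewrite -[RHS]h; apply: eq_bigr => i _; rewrite cE !mxE.
Qed.

Lemma ipDl x y z : ip (x + y) z = ip x z + ip y z.
Proof. exact: linearDl. Qed.
Lemma ipZl (a : R[i]) x z : ip (a *: x) z = a * ip x z.
Proof. by rewrite linearZl_LR. Qed.
Lemma ipDr x y z : ip z (x + y) = ip z x + ip z y.
Proof. exact: linearD. Qed.
Lemma ipZr (a : R[i]) x z : ip z (a *: x) = Num.conj a * ip z x.
Proof. by rewrite linearZ_LR. Qed.
Lemma ipBl x y z : ip (x - y) z = ip x z - ip y z.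
Proof. exact: linearBl. Qed.
Lemma ip0l x : ip 0 x = 0.
Proof. by have := ipZl 0 0 x; rewrite scaler0 mul0r. Qed.

Lemma ip_suml n (c : nat -> R[i]) (e : nat -> H) y :
  ip (\sum_(i < n) c i *: e i) y = \sum_(i < n) c i * ip (e i) y.
Proof.
elim: n => [|n IH]; first by rewrite !big_ord0 ip0l.
by rewrite !big_ord_recr /= ipDl ipZl IH.
Qed.

Lemma ip_sumr n (c : nat -> R[i]) (e : nat -> H) y :
  ip y (\sum_(i < n) c i *: e i) = \sum_(i < n) Num.conj (c i) * ip y (e i).
Proof.
rewrite ipC ip_suml rmorph_sum/=; apply: eq_bigr => i _.
by rewrite rmorphM/= -ipC.
Qed.

Definition csub (V : set H) := V 0 /\ forall (a : R[i]) x y, V x -> V y -> V (a *: x + y).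

Lemma csub_sum V n (c : nat -> R[i]) (e : nat -> H) : csub V ->
  (forall i, (i < n)%N -> V (e i)) -> V (\sum_(i < n) c i *: e i).
Proof.
move=> [V0 VD]; elim: n => [|n IH] Ve; first by rewrite big_ord0.
rewrite big_ord_recr /= addrC; apply: VD; first exact: Ve.
by apply: IH => i ni; apply: Ve; rewrite ltnS ltnW.
Qed.

(** Only the first n values count; total families on [nat] can be extended and compared without
    casts between ordinals. *)
Definition onf n (f : nat -> H) :=
  forall i j, (i < n)%N -> (j < n)%N -> ip (f i) (f j) = (i == j)%:R.

Lemma onf_coef n f (c : nat -> R[i]) j : onf n f -> (j < n)%N ->
  ip (\sum_(i < n) c i *: f i) (f j) = c j.
Proof.
move=> fo jn; rewrite ip_suml (bigD1 (Ordinal jn))//= fo// eqxx mulr1 big1 ?addr0//.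
move=> i ij; rewrite fo//; case: eqP => [ij'|_]; last by rewrite mulr0.
by move/eqP: ij; case; apply: val_inj.
Qed.

(** An orthonormal family of maximal size spans V, since the normalized residual of a vector outside
    its span would extend it. *)
Lemma max_onf V : csub V -> (forall n, exists2 f, onf n f & forall i, (i < n)%N -> V (f i)) \/
  exists n f, [/\ onf n f, forall i, (i < n)%N -> V (f i)
    & forall x, V x -> x = \sum_(i < n) ip x (f i) *: f i].
Proof.
move=> Vs; have [|nP] := pselect (forall n, exists2 f, onf n f & forall i, (i < n)%N -> V (f i)).
  by left.
right; move/existsNP: nP => [N NP].
pose P n := exists2 f, onf n f & forall i, (i < n)%N -> V (f i).
have P0 : P 0%N by exists (fun=> 0).
have [n [[f fo fV] nPn]] : exists n, P n /\ ~ P n.+1.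
  elim: N NP => [//|N IH] NP; have [PN|/IH//] := pselect (P N).
  by exists N.
exists n, f; split=> // x Vx; apply: contrapT => xN.
have [y yE] : exists y, y = x - \sum_(i < n) ip x (f i) *: f i by eexists.
have g0 : y <> 0 by move=> y0; apply: xN; apply/subr0_eq; rewrite -yE.
apply: nPn; have Vy : V y.
  rewrite yE -[- _]scaleN1r addrC; case: (Vs) => V0 VD; apply: VD => //.
  exact: (@csub_sum V n (fun k => ip x (f k)) f Vs fV).
have yf i : (i < n)%N -> ip y (f i) = 0.
  move=> ni; rewrite yE ipBl.
  by rewrite (onf_coef (fun k => ip x (f k)) fo ni) subrr.
have yn := nrm_gt0 g0.
have [y' [Vy' y'1 y'f]] : exists y', [/\ V y', ip y' y' = 1
    & forall i, (i < n)%N -> ip y' (f i) = 0].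
  exists (((nrm y)^-1)%:C *: y); split.
  - by case: Vs => V0 VD; rewrite -[_ *: _]addr0; exact: VD.
  - by rewrite ip_norm nrmE nrmZ ger0_norm ?invr_ge0 ?nrm_ge0// mulVf ?expr1n// lt0r_neq0.
  - by move=> i ni; rewrite ipZl yf// mulr0.
exists (fun i => if (i < n)%N then f i else y').
  move=> i j; rewrite !ltnS (leq_eqVlt i) (leq_eqVlt j) => /predU1P[->|ni] /predU1P[->|nj].
  - by rewrite ltnn y'1 eqxx.
  - by rewrite ltnn nj y'f// gtn_eqF.
  - by rewrite ltnn ni ipC y'f// rmorph0 ltn_eqF.
  - by rewrite ni nj; exact: fo.
move=> i; rewrite ltnS (leq_eqVlt i) => /predU1P[->|ni]; last by rewrite ni; exact: fV.
by rewrite ltnn.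
Qed.

Lemma onf_le_span n m f e : onf n f ->
  (forall i, (i < n)%N -> exists c : nat -> R[i], f i = \sum_(j < m) c j *: e j) -> (n <= m)%N.
Proof.
move=> fo fe; rewrite leqNgt; apply/negP => mn.
have /choice[c fc] : forall i, exists c : nat -> R[i], (i < n)%N -> f i = \sum_(j < m) c j *: e j.
  move=> i; have [/fe[c ->]|] := boolP (i < n)%N; first by exists c.
  by exists (fun=> 0).
have [d [[k kn dk] dM]] := nontrivial_kernel c mn.
have /(congr1 (fun x => ip x (f k))) : \sum_(i < n) d i *: f i = 0.
  transitivity (\sum_(i < n) \sum_(j < m) (d i * c i j) *: e j).
    by apply: eq_bigr => i _; rewrite fc// scaler_sumr; apply: eq_bigr => j _; rewrite scalerA.
  rewrite exchange_big /= big1// => j _; rewrite -scaler_suml dM//.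
  exact: scale0r.
rewrite onf_coef// ip0l; exact/eqP.
Qed.

Lemma has_dim_onf V m : has_dim V m ->
  exists f, [/\ onf m f, forall i, (i < m)%N -> V (f i)
    & forall x, V x -> x = \sum_(i < m) ip x (f i) *: f i].
Proof.
move=> [e [efree VE]].
pose e' k := if insub k is Some i then e i else 0.
have e'E (i : 'I_m) : e' i = e i by rewrite /e' valK.
have VE' x : V x <-> exists c : nat -> R[i], x = \sum_(j < m) c j *: e' j.
  rewrite VE; split=> [[c _ <-]|[c ->]].
    exists (fun k => if insub k is Some i then c i else 0).
    by apply: eq_bigr => i _; rewrite valK e'E.
  by exists (c \o val) => //; apply: eq_bigr => i _; rewrite e'E.
have Vs : csub V.
  split; first by apply/VE'; exists (fun=> 0); rewrite big1// => i _; rewrite scale0r.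
  move=> a x y /VE'[c ->] /VE'[d ->]; apply/VE'; exists (fun k => a * c k + d k).
  rewrite scaler_sumr -big_split/=; apply: eq_bigr => i _.
  by rewrite scalerDl scalerA.
case: (max_onf Vs) => [/(_ m.+1)[f fo fV]|[n [f [fo fV fs]]]].
  have : (m.+1 <= m)%N; last by rewrite ltnn.
  by apply: (@onf_le_span m.+1 m f e' fo) => i im; exact/VE'/fV.
have nm : (n <= m)%N.
  by apply: (@onf_le_span n m f e' fo) => i ni; exact/VE'/fV.
suff mn : n = m by exists f; rewrite -mn.
apply/eqP; rewrite eqn_leq nm /= leqNgt; apply/negP => n_lt_m.
(* If n < m, some nontrivial combination of the e' is orthogonal to all f, hence 0, against
   independence. *)
have [c [[k km ck] cM]] := nontrivial_kernel (fun i j => ip (e' i) (f j)) n_lt_m.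
have v0 : \sum_(i < m) c i *: e' i = 0.
  rewrite [LHS]fs; last by apply/VE'; exists c.
  by rewrite big1// => j _; rewrite ip_suml cM// scale0r.
have := efree (c \o val); rewrite (_ : \sum_(i < m) _ = 0).
  by move=> /(_ erefl (Ordinal km))/=; exact/eqP.
by rewrite -[RHS]v0; apply: eq_bigr => i _; rewrite e'E.
Qed.

Lemma onf_has_dim V n f : csub V -> onf n f -> (forall i, (i < n)%N -> V (f i)) ->
  (forall x, V x -> x = \sum_(i < n) ip x (f i) *: f i) -> has_dim V n.
Proof.
move=> Vs fo fV fs; exists (f \o val); split.
  move=> c c0 i; pose c' k := if insub k is Some i then c i else 0.
  have c'E (j : 'I_n) : c' j = c j by rewrite /c' valK.
  rewrite -c'E -(onf_coef c' fo (ltn_ord i)).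
  rewrite (_ : \sum_(j < n) _ = 0) ?ip0l//.
  by rewrite -[RHS]c0; apply: eq_bigr => j _; rewrite c'E.
apply/seteqP; split=> x; first by move=> /fs ->; exists (fun i => ip x (f i)).
move=> [c _ <-]; pose c' k := if insub k is Some i then c i else 0.
have -> : \sum_(i < n) c i *: (f \o val) i = \sum_(i < n) c' i *: f i.
  by apply: eq_bigr => i _; rewrite /c' valK.
exact: (@csub_sum V n c' f Vs fV).
Qed.

(* The form of [S] is at least [nu] on some [n]-dimensional subspace; by the
   min-max principle, [S] then has at least [n] eigenvalues above [nu]. *)
Definition form_above (S : H -> H) (nu : R) n := exists e : nat -> H,
  forall c : nat -> R[i], (exists2 i, (i < n)%N & c i != 0) ->
    \sum_(i < n) c i *: e i <> 0 /\
    nu * nrm (\sum_(i < n) c i *: e i) ^+ 2 <=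
      rip (\sum_(i < n) c i *: e i) (S (\sum_(i < n) c i *: e i)).

Lemma form_aboveW S nu nu' n : nu' <= nu -> form_above S nu n -> form_above S nu' n.
Proof.
move=> nn [e he]; exists e => c /he[v0 vS]; split=> //; apply: le_trans vS.
by rewrite ler_wpM2r ?sqr_ge0.
Qed.

(** Diagonal dominance of the Gram matrix of the form of X, with 2 a_i a_j <= a_i^2 + a_j^2 for the
    off-diagonal terms. *)
Lemma diag_dominant (X : {linear H -> H}) (e : nat -> H) n (alpha delta : R) :
  n%:R * delta < alpha -> 0 <= delta ->
  (forall i, (i < n)%N -> alpha <= rip (e i) (X (e i))) ->
  (forall i j, (i < n)%N -> (j < n)%N -> i != j -> complex.Re `|ip (e i) (X (e j))| <= delta) ->
  forall c : nat -> R[i], (exists2 i, (i < n)%N & c i != 0) ->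
    0 < rip (\sum_(i < n) c i *: e i) (X (\sum_(i < n) c i *: e i)).
Proof.
move=> nd d0 di off c [k kn ck].
pose a i := complex.Re `|c i|.
have a0 i : 0 <= a i by rewrite -ler0c RRe_real ?ger0_real.
have aE j : `|c j| = (a j)%:C by rewrite /a RRe_real ?ger0_real.
have ReS (F : 'I_n -> R[i]) : complex.Re (\sum_(i < n) F i) = \sum_(i < n) complex.Re (F i).
  by elim/big_ind2 : _ => // x1 x2 y1 y2 <- <-; rewrite ReD.
have -> : rip (\sum_(i < n) c i *: e i) (X (\sum_(i < n) c i *: e i)) =
    \sum_(i < n) \sum_(j < n) complex.Re (c i * (Num.conj (c j) * ip (e i) (X (e j)))).
  rewrite /rip ip_suml ReS; apply: eq_bigr => i _.
  rewrite linear_sum (_ : \sum_(j < n) _ = \sum_(j < n) c j *: (X \o e) j).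
    by rewrite ip_sumr mulr_sumr ReS.
  by apply: eq_bigr => j _; rewrite linearZ.
(* Subtracting delta on the diagonal too makes the double sum exactly (alpha - n delta) s. *)
pose F (i j : 'I_n) :=
  (if i == j then alpha * a i ^+ 2 else 0) - delta / 2 * (a i ^+ 2 + a j ^+ 2).
have term (i j : 'I_n) : F i j <= complex.Re (c i * (Num.conj (c j) * ip (e i) (X (e j)))).
  rewrite /F; case: eqP => [<-|/eqP ij].
    have -> : c i * (Num.conj (c i) * ip (e i) (X (e i))) = (a i ^+ 2)%:C * ip (e i) (X (e i)).
      by rewrite mulrA -normCK aE rmorphXn.
    rewrite ReZ -/(rip _ _).
    have h1 : alpha * a i ^+ 2 <= a i ^+ 2 * rip (e i) (X (e i)).
      by rewrite mulrC ler_wpM2l ?sqr_ge0 ?di.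
    have h2 : 0 <= delta * a i ^+ 2 by rewrite mulr_ge0 ?sqr_ge0.
    lra.
  have h : - (a i * a j * delta) <= complex.Re (c i * (Num.conj (c j) * ip (e i) (X (e j)))).
    set z := c i * _; have : `|complex.Re z| <= complex.Re `|z|.
      by rewrite -lecR [X in _ <= X]RRe_real ?ger0_real// normc_ge_Re.
    have -> : complex.Re `|z| = a i * a j * complex.Re `|ip (e i) (X (e j))|.
      by rewrite /z !normrM norm_conjC !aE mulrA -rmorphM ReZ.
    have : a i * a j * complex.Re `|ip (e i) (X (e j))| <= a i * a j * delta.
      by rewrite ler_wpM2l ?mulr_ge0// off.
    by rewrite ler_norml => ? /andP[? _]; lra.
  have h2 : 0 <= delta * (a i - a j) ^+ 2 by rewrite mulr_ge0 ?sqr_ge0.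
  lra.
apply: lt_le_trans (_ : \sum_(i < n) \sum_(j < n) F i j <= _); last first.
  by apply: ler_sum => i _; apply: ler_sum => j _; exact: term.
set s := \sum_(i < n) a i ^+ 2.
have s0 : 0 < s.
  rewrite /s (bigD1 (Ordinal kn))//= ltr_pwDl//.
    rewrite exprn_gt0// lt_neqAle a0 andbT eq_sym; apply/eqP => ak.
    have : (a k)%:C = 0 by rewrite ak.
    by rewrite RRe_real ?ger0_real// => /normr0_eq0/eqP; exact/negP.
  by apply: sumr_ge0 => i _; rewrite sqr_ge0.
have -> : \sum_(i < n) \sum_(j < n) F i j = (alpha - n%:R * delta) * s.
  transitivity (\sum_(i < n) (alpha * a i ^+ 2 - delta / 2 * (n%:R * a i ^+ 2 + s))).
    apply: eq_bigr => i _; rewrite sumrB -mulr_sumr big_split/= sumr_const card_ord -/s.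
    rewrite (bigD1 i)//= eqxx big1 => [|j ji]; first by rewrite addr0 mulr_natl.
    by rewrite eq_sym (negbTE ji).
  rewrite sumrB -!mulr_sumr big_split/= -mulr_sumr sumr_const card_ord -/s.
  by rewrite -[s *+ n]mulr_natl; field.
by rewrite mulr_gt0// subr_gt0.
Qed.

(** * Eigenvalues in the gap *)

Lemma eigenspace_ker (T : operator H) (g : R) (S : {linear H -> H}) (TS : is_res T g S) l x :
  l != g ->
  op_eigenspace T l x <-> ker (shift S (l - g)^-1) x.
Proof.
move=> lg; have lg0 : l - g != 0 by rewrite subr_eq0.
have Sl := linear_rlin S; split.
  move=> [Tx Txl]; have := resK TS Tx; rewrite Txl -scalerBl -rmorphB.
  rewrite (rlinZ _ _ Sl) => Sx; rewrite /ker /shift -{2}Sx scalerA -rmorphM /=.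
  by rewrite mulVf// scale1r subrr.
move=> /subr0_eq Sx.
have xE : x = S ((l - g)%:C *: x) by rewrite (rlinZ _ _ Sl) Sx scalerA -rmorphM /= divff// scale1r.
split; first by rewrite xE; exact: res_dom TS _.
rewrite {1}xE (resE TS) -xE; apply: rip_ext => w; rewrite !ripE; ring.
Qed.

Lemma csub_eigenspace (T : operator H) l : csub (op_eigenspace T l).
Proof.
split.
  split; first exact: op_dom0.
  have := @op_linear _ _ T (-1) 0 0 (op_dom0 T) (op_dom0 T).
  by rewrite !scaleN1r oppr0 addr0 addNr scaler0.
move=> a x y [dx Tx] [dy Ty]; split; first exact: op_domP.
by rewrite op_linear// Tx Ty scalerDr !scalerA mulrC.
Qed.

Lemma eigenspace_orth (T : operator H) l l' x y : sym_op T -> l != l' ->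
  op_eigenspace T l x -> op_eigenspace T l' y -> ip x y = 0.
Proof.
move=> Ts ll [dx Tx] [dy Ty]; have := Ts _ _ dx dy; rewrite Tx Ty ipZl ipZr conj_real.
move/eqP; rewrite -subr_eq0 -mulrBl -rmorphB mulf_eq0 => /orP[|/eqP//].
by move=> /eqP/complexI/eqP; rewrite subr_eq0 (negbTE ll).
Qed.

(** The map x |-> g + 1/x is continuous at nu = 1 / (l - g), with value l; hence S - nu - s is
    bounded below for all small s other than 0. *)
Lemma isolated_reg (T : operator H) (g : R) (S : {linear H -> H}) (Tsym : sym_op T)
    (TS : is_res T g S) l : g < l -> isolated (spectrum T) l ->
  bounded_below_on (perp (ker (shift S (l - g)^-1))) (shift S (l - g)^-1).
Proof.
move=> gl [_ [V Vl Vs]]; have lg0 : 0 < l - g by rewrite subr_gt0.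
have aK z : g + z - g = z :> R by rewrite addrC addKr.
set nu := (l - g)^-1; have nu0 : 0 < nu by rewrite invr_gt0.
have cv : (g + x^-1) @[x --> nu] --> l.
  have -> : l = g + nu^-1 by rewrite invrK addrC subrK.
  by apply: cvgD; [exact: cvg_cst|apply: cvgV => //; rewrite lt0r_neq0].
have /nbhs_ballP[rho /= rho0 Hrho] := cv _ Vl.
(* Capping by nu keeps nu + s positive. *)
pose r := Num.min rho nu / 2.
have r0 : 0 < r by rewrite divr_gt0// lt_min rho0.
have r2 : 2 * r = Num.min rho nu by rewrite mulrC divfK.
apply: (@isolated_bounded_below_perp_ker (shift S nu) r) => //.
  exact: bop_shift (res_bop Tsym TS).
move=> s s0; rewrite r2 lt_min => /andP[s_rho s_nu].
have nus : 0 < nu + s.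
  by move: s_nu; rewrite ltr_norml => /andP[]; lra.
have -> : reg (shift S nu) s = reg S (nu + s).
  rewrite /reg; congr bounded_below_on; apply/funext => x; apply: rip_ext => w.
  by rewrite /shift !ripE; ring.
have l'g : g + (nu + s)^-1 != g by rewrite -subr_eq0 aK invr_eq0 lt0r_neq0.
have := (res_reg Tsym TS l'g).1; rewrite aK invrK; apply.
apply: contrapT => sp.
have : (V `&` spectrum T) (g + (nu + s)^-1).
  split; last exact: sp.
  by apply: Hrho; rewrite -ball_normE /= opprD addNKr normrN.
rewrite Vs /= => e; have h : (nu + s)^-1 = l - g by rewrite -e aK.
have : nu + s = nu by apply: invr_inj; rewrite h invrK.
by move/eqP; rewrite -subr_eq0 addrC addKr (negbTE s0).
Qed.

Lemma spectrum_discrete (T : operator H) (g l : R) : g < l -> (l%:E < gap_eig_infty T g)%E ->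
  spectrum T l -> discrete_spectrum T l.
Proof.
move=> gl lL sl; apply: contrapT => nd.
have : (gap_eig_infty T g <= l%:E)%E by apply: ereal_inf_lbound; exists l.
by rewrite leNgt lL.
Qed.

Lemma enum_fin (T : operator H) g s k : enumerates_gap_eigs T g s -> (s k < gap_eig_infty T g)%E ->
  exists2 l, g < l & s k = l%:E.
Proof.
case=> _ /(_ k) + _; case: (s k) => [l||].
- by rewrite lte_fin => /andP[gl _] lL; exists l.
- by move=> _; rewrite ltNge leey.
- by rewrite ltNge leNye.
Qed.

(** The cardinality clause of [enumerates_gap_eigs] gives a bijection from the indices with value l
    to an orthonormal basis of the eigenspace at l. Labelling by it yields one orthonormal family
    over all levels; the last clause says that it is complete in each eigenspace. *)
Lemma enum_eigenvectors (T : operator H) g s : sym_op T -> enumerates_gap_eigs T g s ->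
  exists f : nat -> H,
  [/\ forall i l, s i = l%:E -> (l%:E < gap_eig_infty T g)%E -> op_eigenspace T l (f i),
      forall i j, (s i < gap_eig_infty T g)%E -> (s j < gap_eig_infty T g)%E ->
        ip (f i) (f j) = (i == j)%:R
    & forall l x, g < l -> (l%:E < gap_eig_infty T g)%E ->
        (forall i, s i = l%:E -> ip x (f i) = 0) ->
        forall y, op_eigenspace T l y -> ip x y = 0].
Proof.
move=> Tsym sE; have [snd sb seig] := sE; set Lam := gap_eig_infty T g.
have /choice[b Hb] : forall l : R, exists b : (nat -> H) * (nat -> nat), g < l -> (l%:E < Lam)%E ->
    exists m, [/\ onf m b.1, forall i, (i < m)%N -> op_eigenspace T l (b.1 i),
      forall x, op_eigenspace T l x -> x = \sum_(i < m) ip x (b.1 i) *: b.1 i &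
      [/\ forall k, s k = l%:E -> (b.2 k < m)%N,
          forall k k', s k = l%:E -> s k' = l%:E -> b.2 k = b.2 k' -> k = k' &
          forall i, (i < m)%N -> exists2 k, s k = l%:E & b.2 k = i]].
  move=> l; have [[gl lL]|nl] := pselect (g < l /\ (l%:E < Lam)%E); last first.
    by exists ((fun=> 0), id) => gl lL; case: nl.
  have [m [dm /card_set_bijP[F [F1 F2 F3]]]] := seig _ gl lL.
  have [f [fo fV fs]] := has_dim_onf dm.
  exists (f, F) => _ _; exists m; split=> //; split=> [k sk|k k' sk sk'|i im] /=.
  - exact: F1.
  - by apply: F2; rewrite inE.
  - by have [k sk <-] := F3 i im; exists k.
pose f i := (b (fine (s i))).1 ((b (fine (s i))).2 i).
have fE i l : s i = l%:E -> f i = (b l).1 ((b l).2 i) by rewrite /f => ->.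
have sg i l : s i = l%:E -> g < l.
  by move=> si; have := sb i; rewrite si lte_fin => /andP[].
have f1 i l : s i = l%:E -> (l%:E < Lam)%E -> op_eigenspace T l (f i).
  move=> si lL; have [m [_ bV _ [b1 _ _]]] := Hb _ (sg _ _ si) lL.
  by rewrite (fE _ _ si); apply: bV; exact: b1.
exists f; split=> // [i j siL sjL|l x gl lL xf y Ty].
  have [l gl si] := enum_fin sE siL; have [l' gl' sj] := enum_fin sE sjL.
  rewrite si in siL; rewrite sj in sjL.
  have [ll|ll] := eqVneq l l'; last first.
    rewrite (eigenspace_orth Tsym ll (f1 _ _ si siL) (f1 _ _ sj sjL)).
    by case: eqP => // ij; move: ll; rewrite ij sj in si; case: si => ->; rewrite eqxx.
  rewrite -ll in sj; have [m [bo _ _ [b1 b2 _]]] := Hb _ gl siL.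
  rewrite (fE _ _ si) (fE _ _ sj) bo; try exact: b1.
  by congr (_%:R); congr nat_of_bool; apply/eqP/eqP => [/b2->|->].
have [m [_ _ bs [_ _ b3]]] := Hb _ gl lL.
rewrite (bs _ Ty) (ip_sumr _ (fun k => ip y ((b l).1 k))) big1// => i _.
by have [k sk <-] := b3 i (ltn_ord i); rewrite -(fE _ _ sk) xf// mulr0.
Qed.

(** If s k exceeded g + 1/nu, only indices below k could carry eigenvalues <= g + 1/nu, and some
    nonzero v of the trial space would be orthogonal to their eigenvectors. On that orthogonal
    complement S - m is bounded below for all m >= nu, so by [form_le] the form of S stays strictly
    below nu. *)
Lemma enum_le (T : operator H) (g : R) (S : {linear H -> H}) s nu k : sym_op T -> is_res T g S ->
  enumerates_gap_eigs T g s -> 0 < nu -> form_above S nu k.+1 -> (s k <= (g + nu^-1)%:E)%E.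
Proof.
move=> Tsym TS sE nu0 [e he]; rewrite leNgt; apply/negP => l_lt.
have [snd sb seig] := sE; have [f [f1 f2 f3]] := enum_eigenvectors Tsym sE.
set l := g + nu^-1 in l_lt.
have gl : g < l by rewrite ltrDl invr_gt0.
have lL : (l%:E < gap_eig_infty T g)%E.
  by apply: lt_le_trans l_lt _; have /andP[] := sb k.
have [Sl Sb Ss] := res_bop Tsym TS.
(* Indices j with s j > l impose the empty condition, which leaves k equations in k + 1 unknowns. *)
pose M i j := if (s j <= l%:E)%E then ip (e i) (f j) else 0.
have [c [cn cM]] := nontrivial_kernel M (ltnSn k).
have [v0 vS] := he c cn; set v := \sum_(i < k.+1) c i *: e i in v0 vS.
pose G : set H := [set x | forall j, (j < k)%N -> (s j <= l%:E)%E -> ip x (f j) = 0].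
have Gv : G v.
  move=> j jk sj; rewrite -[RHS](cM j jk) /v ip_suml; apply: eq_bigr => i _.
  by rewrite /M sj.
have rG : rsub G.
  split; first by move=> j _ _; rewrite ip0l.
  by move=> a x y Gx Gy j jk sj; rewrite ipDl ipZl Gx// Gy// mulr0 addr0.
have GS x : G x -> G (S x).
  move=> Gx j jk sj; have sjL : (s j < gap_eig_infty T g)%E by exact: le_lt_trans lL.
  have [l' gl' sj'] := enum_fin sE sjL; rewrite sj' in sjL.
  have l'g : l' != g by rewrite gt_eqF.
  have /(eigenspace_ker TS _ l'g)/subr0_eq := f1 _ _ sj' sjL.
  by rewrite (res_ip_sym Tsym TS) => ->; rewrite ipZr Gx// mulr0.
have blow m : nu <= m -> bounded_below_on G (shift S m).
  move=> num; have m0 : 0 < m by exact: lt_le_trans num.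
  set lm := g + m^-1; have glm : g < lm by rewrite ltrDl invr_gt0.
  have lmg : (lm - g)^-1 = m by rewrite /lm addrC addKr invrK.
  have lml : lm <= l by rewrite lerD2l lef_pV2.
  have lmL : (lm%:E < gap_eig_infty T g)%E by apply: le_lt_trans lL; rewrite lee_fin.
  have lmg' : lm != g by rewrite gt_eqF.
  have [sp|/contrapT nsp] := pselect (spectrum T lm); last first.
    have [d d0 Hd] := (res_reg Tsym TS lmg').1 nsp; rewrite lmg in Hd.
    by exists d => // x _; exact: Hd.
  have [iso _] := spectrum_discrete glm lmL sp.
  have [d d0 Hd] := isolated_reg Tsym TS glm iso; rewrite lmg in Hd.
  exists d => // x Gx; apply: Hd => y; rewrite -lmg => /(eigenspace_ker TS _ lmg') Ty.
  rewrite /rip (f3 lm x glm lmL _ y Ty)// => i si; apply: Gx; last by rewrite si lee_fin.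
  rewrite ltnNge; apply/negP => /snd; rewrite si => h.
  by have := lt_le_trans l_lt h; rewrite lte_fin ltNge lml.
have [d d0 Hd] := blow nu (lexx _).
(* The lower bound d at nu persists as d / 2 for m within d / 2 of nu; this margin makes the
   contradiction strict. *)
have vle : rip v (S v) <= (nu - d / 2) * nrm v ^+ 2.
  apply: (form_le (res_bop Tsym TS) rG) => // m md.
  have [/blow//|mnu] := leP nu m.
  exists (d / 2) => [|x Gx]; first exact: divr_gt0.
  have xE : shift S nu x = shift S m x - (nu - m)%:C *: x.
    by apply: rip_ext => w; rewrite /shift !ripE; ring.
  have h1 := Hd x Gx; have h2 := nrmB (shift S m x) ((nu - m)%:C *: x).
  rewrite nrmZ gtr0_norm ?subr_gt0// in h2; rewrite xE in h1.
  have h3 : (nu - m) * nrm x <= d / 2 * nrm x.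
    by rewrite ler_wpM2r ?nrm_ge0//; lra.
  lra.
have : d / 2 * nrm v ^+ 2 <= 0 by have := le_trans vS vle; lra.
rewrite leNgt => /negP; apply; apply: mulr_gt0; first exact: divr_gt0.
by rewrite exprn_gt0// nrm_gt0.
Qed.

(** * Enumeration with multiplicities *)

Lemma finite_set_max (A : set R) : finite_set A -> A !=set0 ->
  exists2 m, A m & forall x, A x -> x <= m.
Proof.
move=> /finite_seqP[t ->] [x0 x0t].
suff [m mt mM] : exists2 m, m \in t & forall x, x \in t -> x <= m by exists m.
elim: t x0 x0t => [//|a [|b t] IH] x0 /= _.
  by exists a => [|x]; rewrite inE// => /eqP ->.
have [m mt mM] := IH b (mem_head _ _).
have [am|ma] := leP a m.
  exists m => [|x]; first by rewrite inE mt orbT.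
  by rewrite inE => /predU1P[->//|]; exact: mM.
exists a => [|x]; first by rewrite mem_head.
by rewrite inE => /predU1P[->//|/mM/le_trans]; apply; exact: ltW.
Qed.

Lemma finite_set_min (A : set R) : finite_set A -> A !=set0 ->
  exists2 m, A m & forall x, A x -> m <= x.
Proof.
move=> fA [x0 Ax0]; have [||_ [m Am <-] mM] := @finite_set_max (-%R @` A).
- exact: finite_image.
- by exists (- x0), x0.
by exists m => // x Ax; rewrite -lerN2; apply: mM; exists x.
Qed.

(* The k-th element is the l with N' l <= k < N' l + mult l, where N' l counts
   the elements below l with multiplicity. *)
Lemma nondecreasing_enumeration (P : set R) (mult : R -> nat) (g : R) (L : \bar R) :
  (forall x, P x -> g < x /\ (x%:E < L)%E) -> (forall x, ~ P x -> mult x = 0%N) ->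
  (forall l, g < l -> (l%:E < L)%E -> finite_set (P `&` [set x | x <= l])) ->
  exists s : nat -> \bar R, [/\ nondecreasing_seq s,
    forall k, s k = L \/ exists2 x, P x & s k = x%:E
    & forall l, g < l -> (l%:E < L)%E -> ([set k | s k = l%:E] #= `I_(mult l))%card].
Proof.
move=> Pg mult0 Pfin.
pose sum A := (\big[addn/0%N]_(x \in A) mult x)%N.
pose D l := P `&` [set x | x <= l]; pose D' l := P `&` [set x | x < l].
have D'D l : D' l `<=` D l by move=> x [Px xl]; split=> //; exact: ltW.
have D'fin l : g < l -> (l%:E < L)%E -> finite_set (D' l).
  by move=> gl lL; apply: sub_finite_set (Pfin _ gl lL).
have mono A B : finite_set B -> A `<=` B -> (sum A <= sum B)%N.
  move=> fB AB; rewrite /sum [leqRHS](fsbigID A)// (_ : B `&` A = A) ?leq_addr//.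
  exact/setIidPr.
have sumD l : g < l -> (l%:E < L)%E -> sum (D l) = (sum (D' l) + mult l)%N.
  move=> gl lL; have [Pl|nPl] := pselect (P l).
    have Dl : D l l by split=> //=.
    rewrite /sum (fsbigD1 l)//=; last exact: Pfin.
    rewrite addnC; congr (_ + _)%N; congr (\big[addn/0%N]_(x \in _) mult x).
    apply/seteqP; split=> x /=.
      by move=> [[Px xl] /eqP nxl]; split=> //; rewrite /= lt_neqAle nxl.
    by move=> [Px xl]; split; [split=> //; exact: ltW|move=> xl'; move: xl; rewrite /= xl' ltxx].
  rewrite mult0// addn0; congr sum; apply/seteqP; split=> // x [Px xl]; split=> //=.
  by rewrite lt_neqAle xl andbT; apply/eqP => xl'; apply: nPl; rewrite -xl'.
have sum_lt l l' : l < l' -> g < l' -> (l'%:E < L)%E -> (sum (D l) <= sum (D' l'))%N.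
  move=> ll' gl' lL'; apply: mono; first exact: D'fin.
  by move=> x [Px xl]; split=> //=; exact: le_lt_trans ll'.
have sum_max A : finite_set A -> A `<=` P -> (0 < sum A)%N ->
    exists y, [/\ A y, forall x, A x -> x <= y & (sum A <= sum (D y))%N].
  move=> fA AP sA; have A0 : A !=set0.
    by apply/set0P/eqP => A0; move: sA; rewrite A0 /sum fsbig_set0.
  have [y Ay yM] := finite_set_max fA A0; exists y; split=> //.
  have [gy yL] := Pg _ (AP _ Ay).
  by apply: mono; [exact: Pfin|move=> x Ax; split; [exact: AP|exact: yM]].
pose pos k l := [/\ P l, (sum (D' l) <= k)%N & (k < sum (D l))%N].
have pos_ex k l : g < l -> (l%:E < L)%E -> (k < sum (D l))%N -> exists2 l0, l0 <= l & pos k l0.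
  (* The position is the least element of A: were k already exceeded by the count strictly below it,
     the largest point there would be a smaller element of A. *)
  move=> gl lL kl; pose A := D l `&` [set x | (k < sum (D x))%N].
  have fA : finite_set A by apply: sub_finite_set (Pfin _ gl lL) => x [].
  have [y [Dy _ yl]] := sum_max _ (Pfin _ gl lL) (@subIsetl _ _ _) (leq_ltn_trans (leq0n _) kl).
  have A0 : A !=set0 by exists y; split=> //=; exact: leq_trans yl.
  have [m [[Pm ml] km] mM] := finite_set_min fA A0; exists m => //; split=> //.
  have [gm mL] := Pg _ Pm.
  rewrite leqNgt; apply/negP => km'.
  have sum_gt0 := leq_ltn_trans (leq0n _) km'.
  have [z [[Pz zm] _ zl]] := sum_max _ (D'fin _ gm mL) (@subIsetl _ _ _) sum_gt0.
  have /mM : A z by split; [split=> //; exact: le_trans (ltW zm) ml|exact: leq_trans zl].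
  by rewrite leNgt zm.
have pos_uniq k l l' : pos k l -> pos k l' -> l = l'.
  wlog: l l' / l <= l' => [W pl pl'|ll [Pl _ kl] [Pl' kl' _]].
    by have [ll|/ltW ll] := leP l l'; [exact: W|apply/esym/W].
  move: ll; rewrite le_eqVlt => /predU1P[//|ll]; have [gl' lL'] := Pg _ Pl'.
  by have := leq_trans (sum_lt _ _ ll gl' lL') kl'; rewrite leqNgt kl.
have /choice[s sP] : forall k, exists y : \bar R,
    (exists2 l, pos k l & y = l%:E) \/ (y = L /\ forall l, ~ pos k l).
  move=> k; have [[l pl]|np] := pselect (exists l, pos k l).
    by exists l%:E; left; exists l.
  by exists L; right; split=> // l pl; apply: np; exists l.
have s_pos k l : g < l -> (l%:E < L)%E -> s k = l%:E <-> pos k l.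
  move=> gl lL; split=> [skl|pl].
    case: (sP k) => [[l' pl']|[skL _]]; first by rewrite skl => -[->].
    by move: lL; rewrite -skL skl ltxx.
  by case: (sP k) => [[l' pl' ->]|[_ /(_ l)//]]; rewrite (pos_uniq _ _ _ pl pl').
have s_le k : (s k <= L)%E.
  by case: (sP k) => [[l [Pl _ _] ->]|[-> _]//]; have [_ /ltW] := Pg _ Pl.
exists s; split.
- move=> k k' kk'; case: (sP k') => [[l' [Pl' kl' k'l'] ->]|[-> _]]; last exact: s_le.
  have [gl' lL'] := Pg _ Pl'.
  have [l ll' pl] := pos_ex k _ gl' lL' (leq_ltn_trans kk' k'l').
  have [gl lL] := Pg _ (let: And3 Pl _ _ := pl in Pl).
  by rewrite ((s_pos k l gl lL).2 pl) lee_fin.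
- move=> k; case: (sP k) => [[l [Pl _ _] ->]|[-> _]]; last by left.
  by right; exists l.
move=> l gl lL; apply/card_set_bijP; exists (fun k => k - sum (D' l))%N.
have sl := sumD _ gl lL; split.
- move=> k /= /(s_pos _ _ gl lL)[_ k1 k2] /=.
  by rewrite ltn_subLR// -sl.
- move=> k k' /set_mem/= /(s_pos _ _ gl lL)[_ k1 _] /set_mem/= /(s_pos _ _ gl lL)[_ k1' _] e.
  by rewrite -(subnK k1) e subnK.
move=> i /= im; exists (sum (D' l) + i)%N; last by rewrite addKn.
have Pl : P l by apply: contrapT => /mult0 ml; move: im; rewrite ml.
by apply/(s_pos _ _ gl lL); split=> //; rewrite ?leq_addr// sl ltn_add2l.
Qed.

Lemma spectrum_regular_near (T : operator H) l : sym_op T -> ~ spectrum T l ->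
  exists2 c, 0 < c & forall l', `|l' - l| < c -> ~ spectrum T l'.
Proof.
move=> Ts /contrapT[S TS]; have [c c0 Hc] := res_regular_near Ts TS.
by exists c => // l' /Hc h; apply.
Qed.

(** Infinitely many points would accumulate at some p. As the resolvent set is open on the line, p
    is in the spectrum and p > g; not being isolated, p is essential, yet p <= l lies below the
    essential spectrum above g. *)
Lemma spectrum_finite (T : operator H) (g l : R) : sym_op T -> ~ spectrum T g ->
  (l%:E < gap_eig_infty T g)%E -> finite_set (spectrum T `&` [set x | g < x <= l]).
Proof.
move=> Ts rg lL; apply: contrapT => inf.
have [c c0 Hc] := spectrum_regular_near Ts rg.
set A := _ `&` _ in inf.
have bA : bounded_set A.
  exists (`|g| + `|l|); split; first exact: num_real.
  move=> M hM x [_ /andP[gx xl]]; apply: ltW; apply: le_lt_trans hM.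
  rewrite ler_norml; apply/andP; split.
    by have := ler_norm (- g); rewrite normrN; have := normr_ge0 l; lra.
  by have := ler_norm l; have := normr_ge0 g; lra.
have [p pA] := infinite_bounded_limit_point_nonempty inf bA.
have near r : 0 < r -> exists y, [/\ y != p, A y & `|y - p| < r].
  move=> r0; have [y [yp Ay By]] := pA _ (nbhsx_ballx p r r0); exists y; split=> //.
  by move: By; rewrite -ball_normE /= distrC.
have pl : p <= l.
  rewrite leNgt; apply/negP => lp; have [|y [_ [_ /andP[_ yl]]]] := near (p - l).
    by rewrite subr_gt0.
  by rewrite ltr_norml => /andP[]; lra.
have gp : g < p.
  have [|y [yp [sy /andP[gy _]]]] := near (c / 2); first by rewrite divr_gt0.
  rewrite ltr_norml => /andP[y1 y2].
  have : c <= y - g.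
    rewrite leNgt; apply/negP => ygc; apply: (Hc y) => //.
    by rewrite gtr0_norm// subr_gt0.
  lra.
have sp : spectrum T p.
  apply: contrapT => /(spectrum_regular_near Ts)[d d0 Hd].
  by have [y [_ [sy _]]] := near d d0; move/Hd; apply.
have pL : (p%:E < gap_eig_infty T g)%E by apply: le_lt_trans lL; rewrite lee_fin.
have [iso _] := spectrum_discrete gp pL sp.
have /disj_setPS/(_ p) := @disjoint_isolated_limit_point _ (spectrum T).
apply; split=> // U /pA[y [yp [sy _] Uy]]; by exists y.
Qed.

Lemma has_dim0 (V : set H) : V = [set 0] -> has_dim V 0.
Proof.
move=> ->; exists (fun=> 0); split; first by move=> c _ [].
apply/seteqP; split=> x /=.
  by move=> ->; exists (fun=> 0) => //; rewrite big_ord0.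
by move=> [c _ <-]; rewrite big_ord0.
Qed.

(** An enumeration exists, so the choice in [gap_eigs] does not fall back on its default. *)
Lemma gap_eigs_enumerates (T : operator H) (g : R) (S : {linear H -> H}) :
  sym_op T -> is_res T g S -> enumerates_gap_eigs T g (gap_eigs T g).
Proof.
move=> Ts TS; set L := gap_eig_infty T g.
suff [s sE] : exists s, enumerates_gap_eigs T g s.
  by apply: (@xgetPex _ (fun=> L) [set s | enumerates_gap_eigs T g s]); exists s.
have rg : ~ spectrum T g by move=> sg; apply: sg; exists S; case: TS.
pose P : set R := spectrum T `&` [set l | g < l /\ (l%:E < L)%E].
have /choice[mult Hm] : forall l, exists m, [/\ g < l -> (l%:E < L)%E ->
    has_dim (op_eigenspace T l) m & ~ P l -> m = 0%N].
  move=> l; have [[sl [gl lL]]|nP] := pselect (P l).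
    by have [_ [m [_ dm]]] := spectrum_discrete gl lL sl; exists m; split=> // -[].
  exists 0%N; split=> // gl lL; apply: has_dim0.
  have lg : l != g by rewrite gt_eqF.
  have /contrapT/(res_reg Ts TS lg)[c c0 Hc] : ~ spectrum T l.
    by move=> sl; apply: nP.
  apply/seteqP; split=> x /=; last by move=> ->; case: (csub_eigenspace T l).
  move=> /(eigenspace_ker TS _ lg) Sx; apply: nrm_eq0; apply/eqP.
  by have := Hc x I; rewrite Sx nrm0 pmulr_rle0// => h; rewrite eq_le h nrm_ge0.
have [||l gl lL|s [s1 s2 s3]] := @nondecreasing_enumeration P mult g L.
- by move=> x [_ []].
- by move=> x; have [_] := Hm x; exact.
- apply: sub_finite_set (spectrum_finite Ts rg lL) => x [[sx [gx _]] xl].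
  by split=> //=; rewrite gx.
exists s; split=> //.
  move=> k; case: (s2 k) => [->|[x [_ [gx xL]] ->]]; last by rewrite lte_fin gx/= ltW.
  rewrite lexx andbT.
  (* The padding value must exceed g strictly: a neighbourhood of g is free of spectrum. *)
  have [c c0 Hc] := spectrum_regular_near Ts rg.
  apply: lt_le_trans (_ : ((g + c)%:E <= _)%E); first by rewrite lte_fin ltrDl.
  apply: le_ereal_inf_tmp => _ [l [[sl _] gl] <-]; rewrite lee_fin leNgt; apply/negP => lgc.
  by apply: (Hc l) => //; rewrite gtr0_norm ?subr_gt0//; rewrite /= in gl; lra.
by move=> l gl lL; exists (mult l); split; [have [+ _] := Hm l; exact|exact: s3].
Qed.

(** * Trial spaces from eigenvectors and approximate eigenvectors *)

Lemma Re_normD (a b : R[i]) : complex.Re `|a + b| <= complex.Re `|a| + complex.Re `|b|.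
Proof. by rewrite -lecR rmorphD !RRe_real ?ger0_real//; exact: ler_normD. Qed.

Lemma shift_linear (S : {linear H -> H}) nu : linear (shift S nu).
Proof.
move=> a x y; rewrite /shift linearP !scalerDr !scalerA [nu%:C * a]mulrC -scalerA.
by rewrite opprD addrACA scalerN.
Qed.

Lemma form_above_diag (S : {linear H -> H}) (e : nat -> H) n (nu alpha delta : R) :
  n%:R * delta < alpha -> 0 <= delta ->
  (forall i, (i < n)%N -> alpha <= rip (e i) (shift S nu (e i))) ->
  (forall i j, (i < n)%N -> (j < n)%N -> i != j ->
    complex.Re `|ip (e i) (shift S nu (e j))| <= delta) ->
  form_above S nu n.
Proof.
move=> nd d0 di off; pose X : {linear H -> H} :=
  HB.pack (shift S nu) (GRing.isLinear.Build _ _ _ _ _ (shift_linear S nu)).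
exists e => c cn; have := @diag_dominant X e n alpha delta nd d0 di off c cn.
set v := \sum_(i < n) _; rewrite -[GRing.Linear.sort X v]/(shift S nu v) => vX; split.
  by move=> v0; move: vX; rewrite v0 rip0l ltxx.
by move: vX; rewrite /shift !ripE ripxx subr_gt0 => /ltW.
Qed.

Lemma form_above_eigen (S : {linear H -> H}) (f : nat -> H) n (nu nu' : R) (mu : nat -> R) :
  onf n f -> nu < nu' -> (forall i, (i < n)%N -> nu' <= mu i) ->
  (forall i, (i < n)%N -> S (f i) = (mu i)%:C *: f i) -> form_above S nu n.
Proof.
move=> fo nn mn Sf.
have XE i j : (i < n)%N -> (j < n)%N ->
    ip (f i) (shift S nu (f j)) = (mu j - nu)%:C * (i == j)%:R.
  move=> ni nj; rewrite /shift Sf// -scalerBl -rmorphB ipZr conj_real fo//.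
apply: (@form_above_diag S f n nu (nu' - nu) 0); rewrite ?mulr0 ?subr_gt0//.
  by move=> i ni; rewrite /rip XE// eqxx mulr1 /= lerD2r mn.
by move=> i j ni nj ij; rewrite XE// (negbTE ij) mulr0 normr0.
Qed.

Lemma ip_cauchy_schwarz x y : complex.Re `|ip x y| <= nrm x * nrm y.
Proof.
set z := ip x y; set a := complex.Re `|z|.
have zE : `|z| = a%:C by rewrite RRe_real ?ger0_real.
(* Scaling x by the conjugate of z turns the inner product into the real number |z|^2. *)
have := le_trans (ler_norm _) (cauchy_schwarz (Num.conj z *: x) y).
rewrite {1}/rip ipZl -/z -normCKC zE -rmorphXn /= nrmZc norm_conjC -/a.
have [->|a0] := eqVneq a 0; first by rewrite mulr_ge0 ?nrm_ge0.
rewrite expr2 -mulrA ler_pM2l// lt_neqAle eq_sym a0 -ler0c -zE/=.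
exact: normr_ge0.
Qed.

Lemma finite_pos_lb n (F : nat -> R) : (forall i, (i < n)%N -> 0 < F i) ->
  exists2 c, 0 < c & forall i, (i < n)%N -> c <= F i.
Proof.
elim: n => [|n IH] F0; first by exists 1.
have [|c c0 Hc] := IH; first by move=> i ni; apply: F0; rewrite ltnS ltnW.
exists (Num.min c (F n)) => [|i]; first by rewrite lt_min c0 F0.
by rewrite ltnS leq_eqVlt ge_min => /predU1P[->|/Hc->//]; rewrite lexx orbT.
Qed.

Lemma finite_ub n (F : nat -> R) : exists2 C, 0 < C & forall i, (i < n)%N -> F i <= C.
Proof.
have F0 i : 0 < (1 + `|F i|)^-1 by rewrite invr_gt0 ltr_pwDl.
have [c c0 Hc] := finite_pos_lb (fun i (_ : (i < n)%N) => F0 i).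
exists c^-1 => [|i ni]; first by rewrite invr_gt0.
have := Hc i ni; rewrite -lef_pV2 ?posrE// invrK; have := ler_norm (F i); lra.
Qed.

Lemma not_reg S nu eta : rlin S -> ~ reg S nu -> 0 < eta ->
  exists x, nrm x = 1 /\ nrm (shift S nu x) <= eta.
Proof.
move=> Sl nreg eta0; apply: contrapT => nx; apply: nreg; exists eta => // x _.
have [->|/nrm_gt0 x0] := pselect (x = 0); first by rewrite nrm0 mulr0 nrm_ge0.
rewrite leNgt; apply/negP => lt; apply: nx; exists (((nrm x)^-1)%:C *: x).
rewrite (rlinZ _ _ (rlin_shift nu Sl)) !nrmZ gtr0_norm ?invr_gt0//.
by split; [rewrite mulVf// lt0r_neq0|rewrite mulrC ler_pdivrMr// ltW].
Qed.

(* Unit approximate eigenvectors at distinct points of the spectrum are nearly orthogonal. *)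
Lemma form_above_infinite (T : operator H) (g L : R) (S : {linear H -> H}) n :
  sym_op T -> is_res T g S -> infinite_set (spectrum T `&` [set x | g < x < L]) ->
  form_above S (L - g)^-1 n.
Proof.
move=> Ts TS inf; set thr := (L - g)^-1; have [Sl Sb Ss] := res_bop Ts TS.
have /infiniteP/pcard_leP[l] := inf.
have lA i : (spectrum T `&` [set x | g < x < L]) (l i) by exact: (@funS _ _ _ _ l).
have lB i : (i < n)%N -> [/\ spectrum T (l i), g < l i & l i < L].
  by move=> _; have [? /andP[]] := lA i.
have l_inj i j : l i = l j -> i = j by apply: (@inj _ _ _ l); exact: in_setT.
pose nu i := (l i - g)^-1.
have nu_reg i : (i < n)%N -> ~ reg S (nu i).
  move=> ni; have [sl gl lL] := lB i ni; move=> h; apply: sl.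
  by apply/(res_reg Ts TS) => //; rewrite gt_eqF.
have nu_thr i : (i < n)%N -> 0 < nu i - thr.
  move=> ni; have [_ gl lL] := lB i ni.
  by rewrite subr_gt0 ltf_pV2 ?posrE ?subr_gt0 ?ltrD2r// (lt_trans gl).
have nu_dist i j : (i < n)%N -> (j < n)%N -> i != j -> 0 < `|nu i - nu j|.
  move=> ni nj ij; rewrite normr_gt0 subr_eq0; apply/eqP => /invr_inj/addIr/l_inj.
  by move/eqP: ij.
have [al al0 Hal] := finite_pos_lb nu_thr.
have [D D0 HD] := finite_ub n (fun i => nu i - thr).
have [De De0 HDe] : exists2 d, 0 < d & forall i j, (i < n)%N -> (j < n)%N -> i != j ->
    d <= `|nu i - nu j|.
  have /choice[d Hd] : forall i, exists d, (i < n)%N ->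
      0 < d /\ forall j, (j < n)%N -> i != j -> d <= `|nu i - nu j|.
    move=> i; have [ni|_] := boolP (i < n)%N; last by exists 1.
    have [|d d0 Hd] := @finite_pos_lb n (fun j => if i == j then 1 else `|nu i - nu j|).
      by move=> j nj; case: ifPn => // ij; exact: nu_dist.
    by exists d => _; split=> // j nj ij; have := Hd j nj; rewrite (negbTE ij).
  have [|c c0 Hc] := @finite_pos_lb n d; first by move=> i /Hd[].
  exists c => // i j ni nj ij; apply: le_trans (Hc i ni) _.
  by have [_] := Hd i ni; exact.
pose K := 1 + D * (2 / De).
have K0 : 0 < K by rewrite addr_gt0// mulr_gt0// divr_gt0.
(* The diagonal entries of S - thr will be at least al - eta and the others at most K eta; this eta
   gives n K eta = al - 2 eta < al - eta. *)
pose eta := al / (2 + n%:R * K).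
have nK : 0 < 2 + n%:R * K by rewrite ltr_pwDl// mulr_ge0// ltW.
have eta0 : 0 < eta by rewrite divr_gt0.
have /choice[x Hx] : forall i, exists x, (i < n)%N -> nrm x = 1 /\ nrm (shift S (nu i) x) <= eta.
  move=> i; have [ni|_] := boolP (i < n)%N; last by exists 0.
  by have [x Hx] := not_reg Sl (nu_reg i ni) eta0; exists x.
have shiftE i y : shift S thr y = shift S (nu i) y + (nu i - thr)%:C *: y.
  by apply: rip_ext => w; rewrite /shift !ripE; ring.
have etaE : eta * (2 + n%:R * K) = al by rewrite divfK// lt0r_neq0.
apply: (@form_above_diag S x n thr (al - eta) (eta * K)).
- by rewrite mulrCA ltrBrDl; lra.
- by rewrite mulr_ge0 ?ltW.
- move=> i ni; have [x1 x2] := Hx i ni; rewrite (shiftE i) ripDr ripZr ripxx x1 expr1n mulr1.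
  have := Hal i ni; have := cauchy_schwarz (x i) (shift S (nu i) (x i)).
  by rewrite x1 mul1r ler_norml => /andP[h1 _] h2; lra.
move=> i j ni nj ij; have [xi1 xi2] := Hx i ni; have [xj1 xj2] := Hx j nj.
have hx : `|nu i - nu j| * complex.Re `|ip (x i) (x j)| <= 2 * eta.
  have e1 : (nu i - nu j)%:C * ip (x i) (x j) =
      ip (x i) (shift S (nu j) (x j)) - ip (shift S (nu i) (x i)) (x j).
    rewrite /shift ipBl ipDr -scaleNr -rmorphN !(ipZl, ipZr) conj_real.
    by rewrite (res_ip_sym Ts TS) rmorphB rmorphN; ring.
  have : complex.Re `|(nu i - nu j)%:C * ip (x i) (x j)| <= 2 * eta.
    rewrite e1 mulr_natl mulr2n; apply: le_trans (Re_normD _ _) _; rewrite normrN.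
    apply: lerD; apply: le_trans (ip_cauchy_schwarz _ _) _.
      by rewrite xi1 mul1r.
    by rewrite xj1 mulr1.
  by rewrite normrM -[`|(_)%:C|]RRe_real ?ger0_real// normcR ReZ.
have hx2 : complex.Re `|ip (x i) (x j)| <= 2 / De * eta.
  rewrite mulrAC ler_pdivlMr// mulrC; apply: le_trans hx.
  by rewrite ler_wpM2r ?HDe// -lecR RRe_real ?ger0_real// normr_ge0.
rewrite (shiftE j) ipDr ipZr conj_real.
have hthr : complex.Re `|(nu j - thr)%:C * ip (x i) (x j)| =
    (nu j - thr) * complex.Re `|ip (x i) (x j)|.
  by rewrite normrM -[`|(_)%:C|]RRe_real ?ger0_real// normcR ReZ (gtr0_norm (nu_thr j nj)).
apply: le_trans (Re_normD _ _) _; rewrite hthr.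
have h1 := ip_cauchy_schwarz (x i) (shift S (nu j) (x j)); rewrite xi1 mul1r in h1.
have h2 : (nu j - thr) * complex.Re `|ip (x i) (x j)| <= D * (2 / De * eta).
  apply: ler_pM => //; first exact/ltW/nu_thr; last exact: HD.
  by rewrite -ler0c RRe_real ?ger0_real.
by rewrite /K; lra.
Qed.

(** If l is a limit point of the spectrum, [form_above_infinite] applies. If it is isolated, its
    eigenspace is infinite-dimensional and contains the trial space: a finite positive dimension
    would make l discrete, and dimension 0 would make it regular by [isolated_reg]. *)
Lemma ess_form_above (T : operator H) (g l L : R) (S : {linear H -> H}) n :
  sym_op T -> is_res T g S -> ess_spectrum T l -> g < l -> l < L -> form_above S (L - g)^-1 n.
Proof.
move=> Ts TS [sl nd] gl lL.
have lg : l != g by rewrite gt_eqF.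
have thr : (L - g)^-1 < (l - g)^-1.
  by rewrite ltf_pV2 ?posrE ?subr_gt0 ?ltrD2r// (lt_trans gl).
have : closure (spectrum T) l by exact: subset_closure.
rewrite closure_isolated_limit_point => -[iso|lim]; last first.
  apply: (form_above_infinite n Ts TS); rewrite setIC.
  apply: ((limit_point_infinite_setP _ _).1 lim [set x | g < x < L]).
  have -> : [set x | g < x < L] = `]g, L[%classic.
    by apply/seteqP; split=> x; rewrite /= in_itv.
  by apply: open_nbhs_nbhs; split; [exact: interval_open|rewrite /= in_itv /= gl].
have Sf f : op_eigenspace T l f -> S f = ((l - g)^-1)%:C *: f.
  by move=> /(eigenspace_ker TS _ lg)/subr0_eq.
case: (max_onf (csub_eigenspace T l)) => [/(_ n)[f fo fV]|[m [f [fo fV fs]]]].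
  by apply: (form_above_eigen fo thr (mu := fun=> (l - g)^-1)) => // i /fV/Sf.
have [m0|m_gt0] := posnP m; last first.
  exfalso; apply: nd; split=> //; exists m; split=> //.
  exact: onf_has_dim (csub_eigenspace T l) fo fV fs.
exfalso; apply: sl; apply/(res_reg Ts TS lg).
have [c c0 Hc] := isolated_reg Ts TS gl iso; exists c => // x _; apply: Hc => y Sy.
rewrite (fs y); first by rewrite m0 big_ord0 rip0r.
by apply/(eigenspace_ker TS _ lg).
Qed.

(** The converse half of min-max. Once s k is the padding value, the essential spectrum supplies the
    trial space; otherwise the eigenvectors with indices 0 to k do. *)
Lemma enum_form_above (T : operator H) (g L : R) (S : {linear H -> H}) s k :
  sym_op T -> is_res T g S -> enumerates_gap_eigs T g s -> (s k < L%:E)%E ->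
  form_above S (L - g)^-1 k.+1.
Proof.
move=> Ts TS sE skL; have [snd sb seig] := sE.
have [skI|skI] := leP (gap_eig_infty T g) (s k).
  have /ereal_inf_lt[_ [l [el gl] <-]] := le_lt_trans skI skL.
  by rewrite lte_fin => lL; apply: (ess_form_above k.+1 Ts TS el).
have [f [f1 f2 f3]] := enum_eigenvectors Ts sE.
have siI i : (i < k.+1)%N -> (s i < gap_eig_infty T g)%E.
  by move=> ik; apply: le_lt_trans skI; exact: snd.
have fin i : (i < k.+1)%N -> [/\ g < fine (s i), s i = (fine (s i))%:E & fine (s i) <= fine (s k)].
  move=> ik; have [l gl si] := enum_fin sE (siI i ik); have [lk gk sk] := enum_fin sE skI.
  by rewrite si; split=> //; have := snd i k ik; rewrite si sk lee_fin.
have [gk skE _] := fin k (ltnSn k); rewrite skE lte_fin in skL.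
apply: (@form_above_eigen S f k.+1 _ (fine (s k) - g)^-1 (fun i => (fine (s i) - g)^-1)).
- by move=> i j ik jk; apply: f2; exact: siI.
- by rewrite ltf_pV2 ?posrE ?subr_gt0 ?ltrD2r// (lt_trans gk).
- move=> i ik; have [gi _ sik] := fin i ik.
  by rewrite lef_pV2 ?posrE ?subr_gt0// lerD2r.
move=> i ik; have [gi si _] := fin i ik.
have ig : fine (s i) != g by rewrite gt_eqF.
have /(eigenspace_ker TS _ ig)/subr0_eq// : op_eigenspace T (fine (s i)) (f i).
by apply: f1 => //; rewrite -si; exact: siI.
Qed.

Lemma infty_form_above (T : operator H) (g L : R) (S : {linear H -> H}) n :
  sym_op T -> is_res T g S -> (gap_eig_infty T g < L%:E)%E -> form_above S (L - g)^-1 n.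
Proof.
move=> Ts TS /ereal_inf_lt[_ [l [el gl] <-]]; rewrite lte_fin => lL.
exact: (ess_form_above n Ts TS el).
Qed.

(** By [enum_le] every term of the enumeration is at most g + 1/nu. Were this below the essential
    spectrum, finitely many points of finite multiplicity would exhaust all indices. *)
Lemma infty_le (T : operator H) (g : R) (S : {linear H -> H}) nu : sym_op T -> is_res T g S ->
  0 < nu -> (forall n, form_above S nu n) -> (gap_eig_infty T g <= (g + nu^-1)%:E)%E.
Proof.
move=> Ts TS nu0 fa; have sE := gap_eigs_enumerates Ts TS; set s := gap_eigs T g in sE.
rewrite leNgt; apply/negP; set l := g + nu^-1 => lL.
have rg : ~ spectrum T g by move=> sg; apply: sg; exists S; case: TS.
apply: infinite_nat; rewrite (_ : [set: nat] =
  \bigcup_(x in spectrum T `&` [set x | g < x <= l]) [set k | s k = x%:E]); last first.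
  apply/seteqP; split=> // k _.
  have sk : (s k <= l%:E)%E by apply: (enum_le Ts TS sE nu0); exact: fa.
  have skI := le_lt_trans sk lL; have [x gx skx] := enum_fin sE skI.
  exists x => //; rewrite skx lee_fin in sk; split; last by rewrite /= gx.
  have [f [f1 f2 _]] := enum_eigenvectors Ts sE.
  have skI' := skI; rewrite skx in skI'; have fk := f1 _ _ skx skI'.
  move=> rx; have xg : x != g by rewrite gt_eqF.
  have [c c0 /(_ (f k) I)] := (res_reg Ts TS xg).1 rx.
  have /(eigenspace_ker TS _ xg) -> := fk; rewrite nrm0 pmulr_rle0// => fk0.
  have : ip (f k) (f k) = 1 by rewrite f2// eqxx.
  rewrite (_ : f k = 0) ?ip0l; first by move/eqP; rewrite eq_sym oner_eq0.
  by apply: nrm_eq0; apply/eqP; rewrite eq_le fk0 nrm_ge0.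
apply: bigcup_finite; first exact: spectrum_finite Ts rg lL.
move=> x [_ /andP[gx xl]]; have [_ _ seig] := sE.
have xL : (x%:E < gap_eig_infty T g)%E by apply: le_lt_trans lL; rewrite lee_fin.
have [m [_ cm]] := seig x gx xL.
by apply/finite_setP; exists m.
Qed.

(** * Lower bounds for the unperturbed resolvent *)

(** Used with n = |v|^2, a = <v, SB v>, s = <v, SA v>: the bound n a / (n - kappa a) increases with
    a, so a may be replaced by nu n. *)
Lemma real_transfer (n a s kappa nu : R) : 0 < n -> 0 < nu -> 0 < kappa -> nu * n <= a ->
  kappa * a < n -> n * a <= (n - kappa * a) * s -> kappa * nu < 1 /\ nu / (1 - kappa * nu) * n <= s.
Proof.
move=> n0 nu0 k0 na kan h.
have k1 : kappa * nu < 1.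
  rewrite -(ltr_pM2r n0) mul1r; apply: le_lt_trans kan; rewrite -mulrA.
  by rewrite ler_pM2l.
split=> //; have d0 : 0 < 1 - kappa * nu by rewrite subr_gt0.
rewrite mulrAC ler_pdivrMr//.
have e0 : 0 < n - kappa * a by rewrite subr_gt0.
rewrite -(ler_pM2l e0).
have h1 := ler_wpM2l (ltW d0) h.
have h2 : 0 <= n * (a - nu * n) by rewrite mulr_ge0 ?(ltW n0)// subr_ge0.
lra.
Qed.

(* 1 - kappa Sk is the inverse of 1 + kappa SA, so Cauchy--Schwarz for the
   latter bounds <v, SA v> from below. *)
Lemma scalar_shift_bound SA SB Sk (kappa theta : R) v : bop SA -> rlin Sk ->
  0 < kappa -> kappa * theta < 1 ->
  (forall x, - theta * nrm x ^+ 2 <= rip x (SA x)) ->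
  (forall x, Sk x + SA (kappa%:C *: Sk x) = SA x) ->
  (forall x, rip x (SB x) <= rip x (Sk x)) -> v <> 0 ->
  kappa * rip v (SB v) < nrm v ^+ 2 /\
  nrm v ^+ 2 * rip v (SB v) <= (nrm v ^+ 2 - kappa * rip v (SB v)) * rip v (SA v).
Proof.
move=> [Sl Sb Ss] kl k0 kth Sth SkE SBk v0.
have n0 : 0 < nrm v ^+ 2 by rewrite exprn_gt0 ?nrm_gt0.
pose J x := x + kappa%:C *: SA x.
have Jl : rlin J.
  by move=> a x y; apply: rip_ext => w; rewrite /J Sl !ripE; ring.
have Js : rsym J by move=> x y; rewrite /J !ripE Ss.
have J0 x : (1 - kappa * theta) * nrm x ^+ 2 <= rip x (J x).
  rewrite /J !ripE ripxx.
  by have := ler_wpM2l (ltW k0) (Sth x); lra.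
have Jpos x : setT x -> 0 <= rip x (J x).
  by move=> _; apply: le_trans (J0 x); rewrite mulr_ge0 ?sqr_ge0// subr_ge0 ltW.
have [w wE] : exists w, w = v - kappa%:C *: Sk v by eexists.
have Jw : J w = v.
  apply: rip_ext => z; have /(congr1 (fun y => rip y z)) := SkE v.
  by rewrite /J wE (rlinB _ _ Sl) !(rlinZ _ _ Sl) !ripE => <-; ring.
have := psd_cs Jl Js rsubT Jpos (I : setT w) (I : setT v).
rewrite -Js Jw ripxx.
have h1 : rip w v = nrm v ^+ 2 - kappa * rip v (Sk v) by rewrite wE !ripE ripxx (ripC (Sk v)).
have h2 : 0 < rip v (J v) by apply: lt_le_trans (J0 v); rewrite mulr_gt0// subr_gt0.
have h3 : rip v (J v) = nrm v ^+ 2 + kappa * rip v (SA v) by rewrite /J !ripE ripxx.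
move=> cs; have h4 : (nrm v ^+ 2) ^+ 2 <= (nrm v ^+ 2 - kappa * rip v (SB v)) * rip v (J v).
  apply: le_trans cs _; rewrite ler_pM2r// h1.
  by have := ler_wpM2l (ltW k0) (SBk v); lra.
have h5 : 0 < nrm v ^+ 2 - kappa * rip v (SB v).
  have : 0 < (nrm v ^+ 2 - kappa * rip v (SB v)) * rip v (J v).
    by apply: lt_le_trans h4; rewrite exprn_gt0.
  by rewrite pmulr_lgt0.
split; first by rewrite -subr_gt0.
rewrite h3 in h4; set n := nrm v ^+ 2 in h4 n0 *; set a := rip v (SB v) in h4 *.
set s := rip v (SA v) in h4 *.
have : kappa * (n * a) <= kappa * ((n - kappa * a) * s) by lra.
by rewrite ler_pM2l.
Qed.

Definition proj (p : H -> H) := [/\ rlin p, forall x, p (p x) = p x & rsym p].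

Lemma proj_bnd p : proj p -> bnd p.
Proof.
move=> [pl pp ps]; exists 1 => // x; rewrite mul1r.
have [->|/nrm_gt0 px0] := pselect (p x = 0); first by rewrite nrm0 nrm_ge0.
rewrite -(ler_pM2l px0) -expr2 -ripxx ps pp mulrC.
exact: le_trans (ler_norm _) (cauchy_schwarz _ _).
Qed.

Lemma bop_sandwich p f : proj p -> bop f -> bop (fun x => p (f (p x))).
Proof.
move=> pP [fl fb fs]; have pb := proj_bnd pP; case: (pP) => pl pp ps; split.
- exact: (rlin_comp pl (rlin_comp fl pl)).
- exact: (bnd_comp pb (bnd_comp fb pb)).
by move=> x y; rewrite ps fs ps.
Qed.

(* For z in Ran p0 chosen so that u = z + v - B y with y = SB (z + v) lies in
   Ker p0, one has SA u = y; Cauchy--Schwarz for SA on Ker p0 applied to u and v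
   then gives the bound, because <u, y> <= <v, SB v> - kappa |SB v|^2. *)
Lemma gap_shift_bound SA SB B p0 Q (kappa beta : R) v : bop SA -> bop SB -> bop B ->
  proj p0 -> (forall x, Q (p0 x) = p0 x) -> rlin Q ->
  (forall x, SB (p0 x) = p0 (SB x)) -> (forall x, SB (Q x) = Q (SB x)) ->
  0 < kappa -> 0 < beta ->
  (forall x, rip (p0 x) (SB (p0 x)) <= 0) -> (forall x, p0 x = 0 -> 0 <= rip x (SB x)) ->
  (forall x, 0 <= rip x (B x) <= beta * nrm x ^+ 2) ->
  (forall x, Q x = x -> kappa * nrm x ^+ 2 <= rip x (B x)) ->
  (forall x, rip x (SB x) <= rip x (SA x)) ->
  (forall x, SB x + SA (B (SB x)) = SA x) ->
  p0 v = 0 -> Q v = v -> 0 < rip v (SB v) ->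
  kappa * rip v (SB v) < nrm v ^+ 2 /\
  nrm v ^+ 2 * rip v (SB v) <= (nrm v ^+ 2 - kappa * rip v (SB v)) * rip v (SA v).
Proof.
move=> [Al Ab As] SBb Bb p0P Qp0 Ql Sp0 SQ k0 b0 Sneg Spos B0 BQ mono SBE p0v Qv a0.
have [pl pp ps] := p0P; have [Sl Sb Ss] := SBb; have [Bl Bbd Bs] := Bb.
(* On Ran p0 the condition p0 u = 0 reads (1 + W D) z = p0 B SB v. Both D and W are nonnegative, so
   this is solvable by [one_plus_bounded_below] with theta = 0. *)
pose D x := - p0 (SB (p0 x)); pose W x := p0 (B (p0 x)).
have Db : bop D by exact: (bop_opp (bop_sandwich p0P SBb)).
have Wb : bop W by exact: (bop_sandwich p0P Bb).
have [Dl Dbd Dsym] := Db; have [Wl Wbd Wsym] := Wb.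
have pn x : nrm (p0 x) ^+ 2 <= nrm x ^+ 2.
  have h : nrm (x - p0 x) ^+ 2 = nrm x ^+ 2 - nrm (p0 x) ^+ 2.
    have h1 : rip x (p0 x) = rip (p0 x) (p0 x) by rewrite ps pp.
    by rewrite -!ripxx !ripE (ripC (p0 x) x) h1; ring.
  by rewrite -subr_ge0 -h sqr_ge0.
have [|||Nblow _] := @one_plus_bounded_below D W 0 beta Db Wb b0 _ _ _.
- by rewrite mul0r ltr01.
- move=> x; rewrite /W -ps; have /andP[-> h] := B0 (p0 x).
  by apply: le_trans h _; rewrite ler_wpM2l ?(ltW b0).
- by move=> x; rewrite oppr0 mul0r /D ripNr -ps oppr_ge0; exact: Sneg.
have adj x y : rip (x + W (D x)) y = rip x (y + D (W y)).
  by rewrite ripDl ripDr Wsym Dsym.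
have [z zE] := onto_of_adjoint (one_plus_rlin (rlin_comp Wl Dl)) (one_plus_bnd (bnd_comp Wbd Dbd))
  (one_plus_rlin (rlin_comp Dl Wl)) (one_plus_bnd (bnd_comp Dbd Wbd)) adj Nblow (p0 (B (SB v))).
have pz : p0 z = z.
  have z1 : z = p0 (B (SB v) - B (p0 (D z))) by rewrite (rlinB _ _ pl) -zE addrK.
  by rewrite z1 pp.
have [q qE] : exists q, q = SB v by eexists.
have [y yE] : exists y, y = SB z + q by eexists.
have ySB : y = SB (z + v) by rewrite (rlinD _ _ Sl) yE qE.
have zp : z = p0 (B y).
  have : z - p0 (B (SB z)) = p0 (B q).
    by rewrite qE -zE /= /W /D pz (rlinN _ pl) pp (rlinN _ Bl) (rlinN _ pl) -(Sp0 z) pz.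
  by rewrite yE (rlinD _ _ Bl) (rlinD _ _ pl) => <-; rewrite addrC subrK.
have [u uE] : exists u, u = z + v - B y by eexists.
have pu : p0 u = 0.
  by rewrite uE (rlinB _ _ pl) (rlinD _ _ pl) pz p0v addr0 {1}zp subrr.
have Su : SA u = y by rewrite uE (rlinB _ _ Al) -(SBE (z + v)) -ySB addrK.
have p0q : p0 q = 0 by rewrite qE -Sp0 p0v rlin0.
(* As Ran p0 lies in Ran Q, adding SB z does not leave Ran Q, and B >= kappa can be used at y. *)
have Qy : Q y = y.
  by rewrite yE qE (rlinD _ _ Ql) -!SQ Qv -{1}pz Qp0 pz.
have zq : rip (SB z) q = 0 by rewrite -{1}pz Sp0 ps p0q rip0r.
have zv : rip (SB z) v = 0 by rewrite -{1}pz Sp0 ps p0v rip0r.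
have n0 : 0 < nrm v ^+ 2.
  by rewrite exprn_gt0// nrm_gt0// => v0; move: a0; rewrite v0 rip0l ltxx.
have uy : rip u y <= rip v (SB v) - kappa * nrm q ^+ 2.
  have h1 : rip u y = rip z (SB z) + rip v q - rip (B y) y.
    have zq0 : rip z q = 0 by rewrite qE -Ss zv.
    by rewrite uE !ripDl ripNl {1 2}yE !ripDr zq0 (ripC v (SB z)) zv addr0 add0r.
  have h2 : rip z (SB z) <= 0 by rewrite -pz.
  have h3 := BQ y Qy; rewrite (ripC y) in h3.
  have h4 : nrm y ^+ 2 = nrm (SB z) ^+ 2 + nrm q ^+ 2.
    by rewrite -!ripxx yE !ripE (ripC q) zq; ring.
  have h5 := sqr_ge0 (nrm (SB z)).
  have h6 : kappa * nrm q ^+ 2 <= kappa * nrm y ^+ 2 by rewrite ler_wpM2l ?(ltW k0)// h4 lerDr.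
  by rewrite h1 qE; rewrite qE in h6; lra.
have rG : rsub [set x | p0 x = 0].
  split; first exact: rlin0.
  by move=> a x x' /= px px'; rewrite pl px px' scaler0 addr0.
have cs := psd_cs Al As rG (fun x px => le_trans (Spos x px) (mono x)) pu p0v.
have e1 : rip u (SA v) = rip v (SB v).
  by rewrite -As Su yE ripDl zv add0r qE Ss.
rewrite e1 Su in cs.
have hq : rip v (SB v) ^+ 2 <= nrm v ^+ 2 * nrm q ^+ 2.
  rewrite -exprMn qE -[_ ^+ 2]real_normK ?num_real// ler_sqr ?nnegrE ?mulr_ge0 ?nrm_ge0//.
  exact: cauchy_schwarz.
have as_ := mono v.
set a := rip v (SB v) in a0 uy cs hq as_ *; set s := rip v (SA v) in cs as_ *.
set n := nrm v ^+ 2 in hq n0 *; set m := nrm q ^+ 2 in hq uy.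
have s0 : 0 < s by exact: lt_le_trans as_.
have c1 : a ^+ 2 <= (a - kappa * m) * s by apply: le_trans cs _; rewrite ler_pM2r.
have c2 : 0 < a - kappa * m.
  have : 0 < (a - kappa * m) * s by apply: lt_le_trans c1; rewrite exprn_gt0.
  by rewrite pmulr_lgt0.
have c3 : kappa * a ^+ 2 <= kappa * (n * m) by rewrite ler_pM2l.
have c4 : 0 < n * (a - kappa * m) by rewrite mulr_gt0.
have c5 : kappa * a < n.
  rewrite -(ltr_pM2r a0); lra.
split=> //; rewrite -(ler_pM2l a0).
(* Replacing n m by the smaller a^2 on the right leaves n a^2 <= a (n - kappa a) s. *)
have c6 : n * a ^+ 2 <= n * ((a - kappa * m) * s) by rewrite ler_pM2l.
have c7 : kappa * a ^+ 2 * s <= kappa * (n * m) * s by rewrite ler_pM2r.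
lra.
Qed.

(** The dimension is kept because p kills no nonzero vector of the trial space. *)
Lemma form_above_map (S S' : H -> H) (p : H -> H) n nu nu' : linear p ->
  (forall v, v <> 0 -> nu * nrm v ^+ 2 <= rip v (S v) ->
    p v <> 0 /\ nu' * nrm (p v) ^+ 2 <= rip (p v) (S' (p v))) ->
  form_above S nu n -> form_above S' nu' n.
Proof.
move=> pl hp [e he]; exists (p \o e) => c /he[v0 vS].
suff -> : \sum_(i < n) c i *: (p \o e) i = p (\sum_(i < n) c i *: e i) by exact: hp.
elim: n {he v0 vS} => [|n IH].
  by rewrite !big_ord0; have := pl (-1) 0 0; rewrite !scaleN1r oppr0 addr0 addNr.
by rewrite !big_ord_recr /= IH addrC [in RHS]addrC pl.
Qed.

(** * Spectral measures *)

Lemma integrable_id_of_sq (mu : {measure set (measurableTypeR R) -> \bar R}) :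
  (mu setT < +oo)%E -> (\int[mu]_l (l ^+ 2)%:E < +oo)%E ->
  mu.-integrable setT (fun l : measurableTypeR R => (l : R)%:E).
Proof.
move=> m1 m2; have i1 : mu.-integrable setT (fun _ : measurableTypeR R => 1%:E).
  apply/integrableP; split; first exact: measurable_cst.
  by rewrite (eq_integral (cst 1%:E)) ?integral_cst ?mul1e// => x _; rewrite /= normr1.
have i2 : mu.-integrable setT (fun l : measurableTypeR R => ((l : R) ^+ 2)%:E).
  apply/integrableP; split; first by apply/measurable_EFinP; exact: measurable_funX.
  by under eq_integral do rewrite /= ger0_norm ?sqr_ge0//.
apply: (le_integrable measurableT _ _ (integrableD measurableT i1 i2)).
  by apply/measurable_EFinP; exact: measurable_id.
move=> x _; rewrite /= lee_fin [leRHS]ger0_norm ?addr_ge0 ?sqr_ge0//.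
have e : (x : R) ^+ 2 = `|x : R| ^+ 2 by rewrite real_normK ?num_real.
rewrite e; move: (normr_ge0 (x : R)); set t : R := `|x : R| => t0.
by have := sqr_ge0 (t - 1); lra.
Qed.

Lemma rsym_form0 f : rlin f -> rsym f -> (forall x, rip (f x) x = 0) -> forall x, f x = 0.
Proof.
move=> fl fs f0 x; apply: rip_ext => y; have := f0 (x + y).
by rewrite (rlinD _ _ fl) !ripE !f0 (fs y x) (ripC y); lra.
Qed.

Section SpectralMeasure.
Variables (T : operator H) (P : set R -> H -> H).
Hypothesis Tsym : sym_op T.
Hypothesis PT : spectral_measure ip T P.

Lemma sm_linear J : measurable J -> linear (P J).
Proof. by case: PT => /(_ J) + _ _ => /[apply] -[]. Qed.

Lemma sm_proj J : measurable J -> proj (P J).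
Proof.
move=> mJ; case: PT => /(_ J mJ)[Pl PP Ps] _ _; split=> //.
  by move=> a x y; exact: Pl.
by move=> x y; rewrite /rip Ps.
Qed.

(** [spectral_measure] makes only the forms <P(S) x, x> additive; polarization lifts this to the
    operators, from which orthogonality and multiplicativity follow. *)
Lemma sm_setU J K x : measurable J -> measurable K -> J `&` K = set0 ->
  P (J `|` K) x = P J x + P K x.
Proof.
move=> mJ mK JK.
have [l1 _ s1] := sm_proj (measurableU _ _ mJ mK).
have [l2 _ s2] := sm_proj mJ; have [l3 _ s3] := sm_proj mK.
apply/eqP; rewrite -subr_eq0; apply/eqP.
apply: (@rsym_form0 (fun y => P (J `|` K) y - (P J y + P K y))).
- by move=> a y z; apply: rip_ext => w; rewrite l1 l2 l3 !ripE; ring.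
- by move=> y z; rewrite !ripE s1 s2 s3.
move=> y; case: PT => _ _ /(_ y)[mu [muE _ _]].
have : mu (J `|` K) = (mu J + mu K)%E by exact: measureU.
rewrite !muE ?measurableU//; last exact: measurableU.
by rewrite -EFinD => -[] h; rewrite !ripE /rip h; ring.
Qed.

Lemma sm_disjoint J K x : measurable J -> measurable K -> J `&` K = set0 -> P J (P K x) = 0.
Proof.
move=> mJ mK JK; have [_ p1 s1] := sm_proj (measurableU _ _ mJ mK).
have [l2 p2 s2] := sm_proj mJ; have [l3 p3 s3] := sm_proj mK.
have h y : rip (P J y) (P K y) = 0.
  have : rip (P (J `|` K) y) (P (J `|` K) y) = rip (P (J `|` K) y) y by rewrite s1 p1 s1.
  rewrite sm_setU// !ripE (ripC (P K y) (P J y)).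
  have -> : rip (P J y) y = rip (P J y) (P J y) by rewrite [RHS]s2 p2 s2.
  have -> : rip (P K y) y = rip (P K y) (P K y) by rewrite [RHS]s3 p3 s3.
  lra.
apply/nrm_eq0/eqP; rewrite -sqrf_eq0 -ripxx; apply/eqP.
by rewrite s2 p2 -s2; have := h (P K x); rewrite p3.
Qed.

Lemma sm_setI J K x : measurable J -> measurable K -> P J (P K x) = P (J `&` K) x.
Proof.
move=> mJ mK; have mI := measurableI _ _ mJ mK.
have mD1 := measurableD mJ mK; have mD2 := measurableD mK mJ.
have [lJ _ _] := sm_proj mJ.
have dis (A B : set R) : (A `&` B) `&` (B `\` A) = set0.
  by apply/seteqP; split=> // y [[Ay _] [_ nAy]].
have dec (A B : set R) : (A `&` B) `|` (B `\` A) = B.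
  by rewrite setIC setUIDK.
have -> : P K x = P (J `&` K) x + P (K `\` J) x by rewrite -sm_setU// dec.
rewrite (rlinD _ _ lJ) (@sm_disjoint J (K `\` J))//; last exact: setDIK.
have mKJ : measurable (K `&` J) by exact: measurableI.
rewrite addr0 -{1}[J](dec K J) (sm_setU _ mKJ mD1 (dis _ _)).
rewrite [K `&` J]setIC [P (J `\` K) _]sm_disjoint//.
  by rewrite addr0; case: (sm_proj mI).
by rewrite setIC [J `&` K]setIC; exact: dis.
Qed.

Lemma sm_comm J K x : measurable J -> measurable K -> P J (P K x) = P K (P J x).
Proof. by move=> mJ mK; rewrite !sm_setI// setIC. Qed.

Lemma sm_form_split J S y : measurable J -> measurable S ->
  rip (P S y) y = rip (P S (P J y)) (P J y) + rip (P S (y - P J y)) (y - P J y).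
Proof.
move=> mJ mS; have [lJ pJ sJ] := sm_proj mJ; have [lS pS sS] := sm_proj mS.
have h : rip (P S y) (P J y) = rip (P S (P J y)) (P J y).
  by rewrite -{1}pJ -sJ (sm_comm _ mJ mS).
have h2 : rip (P S (P J y)) y = rip (P S y) (P J y) by rewrite sS ripC.
by rewrite (rlinB _ _ lS) !ripE h2 h; ring.
Qed.

Lemma sm_measure y : exists mu : {measure set (measurableTypeR R) -> \bar R},
  [/\ forall S, measurable S -> mu S = (rip (P S y) y)%:E,
      mu setT = (nrm y ^+ 2)%:E,
      op_dom T y <-> (\int[mu]_l (l ^+ 2)%:E < +oo)%E,
      op_dom T y -> mu.-integrable setT (fun l : measurableTypeR R => (l : R)%:E)
    & op_dom T y -> (rip (T y) y)%:E = (\int[mu]_l l%:E)%E].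
Proof.
have [_ PsetT /(_ y)[mu [m1 m2 m3]]] := PT; exists mu.
have mT : mu setT = (nrm y ^+ 2)%:E by rewrite m1// PsetT -ripxx.
have int : op_dom T y -> mu.-integrable setT (fun l : measurableTypeR R => (l : R)%:E).
  by move=> /m2; apply: integrable_id_of_sq; rewrite mT ltry.
split=> // Ty; rewrite /rip m3// /= /Rintegral fineK//.
exact: integrable_fin_num (int Ty).
Qed.

(** The measure of y is the sum of those of P J y and y - P J y, so both the finiteness of the
    second moment, which is membership in the domain, and the first moment split. *)
Lemma sm_split_dom J y : measurable J -> op_dom T y ->
  [/\ op_dom T (P J y), op_dom T (y - P J y)
    & rip (T y) y = rip (T (P J y)) (P J y) + rip (T (y - P J y)) (y - P J y)].
Proof.
move=> mJ Ty; have [mu [m1 _ m3 m4 m5]] := sm_measure y.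
have [mu1 [n1 _ n3 n4 n5]] := sm_measure (P J y).
have [mu2 [p1 _ p3 p4 p5]] := sm_measure (y - P J y).
have e (f : R -> \bar R) : (\int[mu]_l f l = \int[measure_add mu1 mu2]_l f l)%E.
  apply: eq_measure_integral => S mS _; rewrite [RHS]measure_addE m1// n1// p1//.
  by rewrite -EFinD -sm_form_split.
have sq : (\int[mu]_l (l ^+ 2)%:E = \int[mu1]_l (l ^+ 2)%:E + \int[mu2]_l (l ^+ 2)%:E)%E.
  rewrite e ge0_integral_measure_add//; first by move=> x _; rewrite lee_fin sqr_ge0.
  by apply/measurable_EFinP; exact: measurable_funX.
have ge0 (nu : {measure set (measurableTypeR R) -> \bar R}) : (0 <= \int[nu]_l ((l : R) ^+ 2)%:E)%E.
  by apply: integral_ge0 => x _; rewrite lee_fin sqr_ge0.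
have /m3 := Ty; rewrite sq => lty.
have d1 : op_dom T (P J y) by apply/n3; apply: le_lt_trans lty; rewrite leeDl.
have d2 : op_dom T (y - P J y) by apply/p3; apply: le_lt_trans lty; rewrite leeDr.
split=> //; apply: EFin_inj; rewrite EFinD m5// n5// p5// e.
by rewrite integral_measure_add//; [exact: n4|exact: p4].
Qed.

Lemma op_addE x y : op_dom T x -> op_dom T y -> op_dom T (x + y) /\ T (x + y) = T x + T y.
Proof.
move=> Tx Ty; have := op_domP 1 Tx Ty; have := op_linear 1 Tx Ty.
by rewrite !scale1r.
Qed.

Lemma sm_cross J x y : measurable J -> op_dom T x -> op_dom T y -> P J x = x -> P J y = 0 ->
  rip (T x) y = 0.
Proof.
move=> mJ Tx Ty Jx Jy; have [Txy E] := op_addE Tx Ty; have [lJ _ _] := sm_proj mJ.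
have [_ _] := sm_split_dom mJ Txy; rewrite (rlinD _ _ lJ) Jx Jy addr0 [x + y - x]addrAC subrr add0r.
rewrite E !ripE; have : rip (T y) x = rip (T x) y by rewrite /rip Tsym// -/(rip y (T x)) ripC.
by move=> ->; lra.
Qed.

Lemma sm_bound J x (c : R) : measurable J -> op_dom T x -> P J x = x ->
  ((forall l, J l -> c <= l) -> c * nrm x ^+ 2 <= rip (T x) x) /\
  ((forall l, J l -> l <= c) -> rip (T x) x <= c * nrm x ^+ 2).
Proof.
move=> mJ Tx Jx; have [mu [m1 m2 _ m4 m5]] := sm_measure x.
have mN : measurable (~` J) by exact: measurableC.
have muJ : mu J = (nrm x ^+ 2)%:E by rewrite m1// Jx ripxx.
have muN : mu (~` J) = 0%E.
  by rewrite m1// -Jx sm_disjoint ?setICl// rip0l.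
have iJ : mu.-integrable J (fun l : measurableTypeR R => (l : R)%:E).
  by apply: integrableS (m4 Tx).
have ic : mu.-integrable J (fun _ : measurableTypeR R => c%:E).
  apply/integrableP; split; first exact: measurable_cst.
  by rewrite integral_cst//= muJ -EFinM ltry.
have Ic : (\int[mu]_(l in J) c%:E = (c * nrm x ^+ 2)%:E)%E.
  by rewrite integral_cst// muJ.
have IJ : (rip (T x) x)%:E = (\int[mu]_(l in J) l%:E)%E.
  rewrite m5// (@negligible_integral _ _ _ mu setT (~` J))//; last exact: m4.
  by rewrite setTD setCK.
split=> hJ; rewrite -lee_fin IJ -Ic; apply: le_integral => //;
  by move=> l /set_mem /hJ; rewrite lee_fin.
Qed.

Variables (g : R) (S : {linear H -> H}).
Hypothesis TS : is_res T g S.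

(** The measure describes T only through its form, so commutation is checked weakly. For y = S x the
    cross terms vanish by [sm_cross]; hence (T - g) P J y and P J x have the same inner product with
    every S z, and S is symmetric and injective. *)
Lemma sm_res_comm J x : measurable J -> S (P J x) = P J (S x).
Proof.
move=> mJ; have [lJ pJ sJ] := sm_proj mJ; have [Sl Sb Ss] := res_bop Tsym TS.
have dy := res_dom TS x; have [y yE] : exists y, y = S x by eexists.
rewrite -yE in dy *; have [du dw _] := sm_split_dom mJ dy.
have Jw : P J (y - P J y) = 0 by rewrite (rlinB _ _ lJ) pJ subrr.
have xE : x = T y - g%:C *: y by rewrite yE (resE TS) addrK.
rewrite -[RHS](resK TS du); congr (S _).
apply/eqP; rewrite -subr_eq0; apply/eqP; apply: (res_inj TS).
apply: rip_ext => z; rewrite rip0l Ss.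
have dz := res_dom TS z; have [y' y'E] : exists y', y' = S z by eexists.
rewrite -y'E in dz *; have [du' dw' _] := sm_split_dom mJ dz.
have Jw' : P J (y' - P J y') = 0 by rewrite (rlinB _ _ lJ) pJ subrr.
have [u uE] : exists u, u = P J y by eexists.
have [w wE] : exists w, w = y - P J y by eexists.
have [u' u'E] : exists u', u' = P J y' by eexists.
have [w' w'E] : exists w', w' = y' - P J y' by eexists.
have Ju : P J u = u by rewrite uE pJ.
have Ju' : P J u' = u' by rewrite u'E pJ.
have y'S : y' = u' + w' by rewrite u'E w'E addrC subrK.
have yS : y = u + w by rewrite uE wE addrC subrK.
rewrite -wE in dw Jw; rewrite -uE in du *.
rewrite -w'E in dw' Jw'; rewrite -u'E in du'.
have [_ Ty] := op_addE du dw; rewrite -yS in Ty.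
have c1 : rip (T w) u' = 0.
  have : rip (T w) u' = rip (T u') w by rewrite /rip Tsym// -/(rip w (T u')) ripC.
  by rewrite (sm_cross mJ du' dw Ju' Jw).
have c2 : rip (T u) w' = 0 by exact: sm_cross mJ du dw' Ju Jw'.
have c3 : rip w u' = 0 by rewrite -Ju' -sJ Jw rip0l.
have c4 : rip u w' = 0 by rewrite -Ju sJ Jw' rip0r.
rewrite !(ripDl, ripNl) ripZl sJ {1}y'S (rlinD _ _ lJ) Ju' Jw' addr0.
by rewrite xE Ty yS y'S !ripE c1 c2 c3 c4; ring.
Qed.

End SpectralMeasure.

(** The form bounds come from <x, S x> = <T S x, S x> - g |S x|^2 and the bounds of T on spectral
    subspaces. Above E this gives (E - g) |S x|^2 <= <x, S x>, hence |S x| <= |x| / (E - g) by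
    Cauchy--Schwarz. *)
Lemma spectral_cut (T : operator H) P (g E : R) (S : {linear H -> H}) :
  sym_op T -> spectral_measure ip T P -> is_res T g S -> g < E ->
  let p0 := P `]-oo, g]%classic in let Q := P `]-oo, E]%classic in
  [/\ [/\ linear p0, proj p0, linear Q & proj Q],
      (forall x, Q (p0 x) = p0 x) /\ (forall x, p0 (Q x) = p0 x),
      (forall x, S (p0 x) = p0 (S x)) /\ (forall x, S (Q x) = Q (S x)),
      (forall x, rip (p0 x) (S (p0 x)) <= 0) /\ (forall x, p0 x = 0 -> 0 <= rip x (S x))
    & forall x, Q x = 0 -> rip x (S x) <= (E - g)^-1 * nrm x ^+ 2].
Proof.
move=> Ts PT TS gE p0 Q.
have m0 : measurable (`]-oo, g]%classic : set R) by exact: measurable_itv.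
have mQ : measurable (`]-oo, E]%classic : set R) by exact: measurable_itv.
have p0P := sm_proj PT m0; have QP := sm_proj PT mQ.
have S0 x : S (p0 x) = p0 (S x) by exact: (sm_res_comm Ts PT TS x m0).
have SQ x : S (Q x) = Q (S x) by exact: (sm_res_comm Ts PT TS x mQ).
have I0 : `]-oo, E]%classic `&` `]-oo, g]%classic = (`]-oo, g]%classic : set R).
  apply/setIidPr => l /=; rewrite !in_itv /= => lg; exact: le_trans lg (ltW gE).
have [Sl Sb Ss] := res_bop Ts TS.
have compl (e : R) x : P `]-oo, e]%classic x = 0 -> P `]e, +oo[%classic x = x.
  move=> x0; have me : measurable (`]-oo, e]%classic : set R) by exact: measurable_itv.
  have me' : measurable (`]e, +oo[%classic : set R) by exact: measurable_itv.
  have [_ PsetT _] := PT; rewrite -[RHS](PsetT x).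
  have -> : [set: R] = `]-oo, e]%classic `|` `]e, +oo[%classic.
    apply/seteqP; split=> // l _ /=; rewrite !in_itv /= andbT; apply/orP.
    by rewrite le_eqVlt; case: ltgtP.
  rewrite (sm_setU PT _ me me') ?x0 ?add0r//.
  by apply/seteqP; split=> // l [] /=; rewrite !in_itv /= andbT => le; rewrite ltNge le.
have formE x : rip x (S x) = rip (T (S x)) (S x) - g * nrm (S x) ^+ 2.
  by rewrite (resE TS) ripDl ripZl ripxx addrK.
have low (e : R) x : P `]-oo, e]%classic x = 0 -> (e - g) * nrm (S x) ^+ 2 <= rip x (S x).
  move=> x0; have me : measurable (`]-oo, e]%classic : set R) by exact: measurable_itv.
  have me' : measurable (`]e, +oo[%classic : set R) by exact: measurable_itv.
  have Su : P `]e, +oo[%classic (S x) = S x.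
    by apply: compl; rewrite -(sm_res_comm Ts PT TS x me) x0 (rlin0 Sl).
  have [+ _] := sm_bound PT e me' (res_dom TS x) Su.
  rewrite formE mulrBl lerD2r; apply=> l /=; rewrite in_itv /= andbT; exact: ltW.
split.
- by split=> //; [exact: (sm_linear PT m0)|exact: (sm_linear PT mQ)].
- by split=> x; rewrite /p0 /Q (sm_setI PT)// ?I0// setIC I0.
- by [].
- split=> x.
    have [_ p0p0 _] := p0P; have Su : p0 (S (p0 x)) = S (p0 x) by rewrite S0; exact: p0p0.
    have [_] := sm_bound PT g m0 (res_dom TS (p0 x)) Su.
    rewrite formE subr_le0; apply=> l /=; by rewrite in_itv.
  by move=> /low; rewrite subrr mul0r.
move=> x /low h; have Eg : 0 < E - g by rewrite subr_gt0.
have h1 := le_trans (ler_norm _) (cauchy_schwarz x (S x)).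
rewrite -(ler_pM2l Eg) mulrA divff ?lt0r_neq0// mul1r.
have [n0|/nrm_gt0 n0] := pselect (S x = 0).
  by rewrite n0 rip0r mulr0 sqr_ge0.
have h2 : (E - g) * nrm (S x) <= nrm x.
  rewrite -(ler_pM2r n0) -mulrA -expr2; exact: le_trans h h1.
apply: le_trans (_ : (E - g) * (nrm x * nrm (S x)) <= _); first by rewrite ler_pM2l.
by rewrite mulrCA expr2 ler_wpM2l ?nrm_ge0.
Qed.

(** * From trial spaces to eigenvalue inequalities *)

Lemma gap_eig_transfer (T T' : operator H) (g E kappa : R) (S S' : {linear H -> H}) :
  sym_op T -> is_res T g S -> sym_op T' -> is_res T' g S' ->
  (forall nu n, (E - g)^-1 < nu -> 0 < nu -> form_above S nu n.+1 ->
     0 < nu^-1 - kappa /\ form_above S' (nu^-1 - kappa)^-1 n.+1) ->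
  forall k, (gap_eig T g k < E%:E)%E -> (gap_eig T' g k + kappa%:E <= gap_eig T g k)%E.
Proof.
move=> Ts TS Ts' TS' tr k kE; have sE := gap_eigs_enumerates Ts TS.
have [snd sb _] := sE; have sE' := gap_eigs_enumerates Ts' TS'.
have gk : (g%:E < gap_eig T g k)%E.
  case: k {kE} => [k|] /=; first by have /andP[] := sb k.
  by have /andP[h1 h2] := sb 0%N; exact: lt_le_trans h2.
have [lam lamE] : exists lam, gap_eig T g k = lam%:E.
  by case: (gap_eig T g k) kE gk => [l||]//; exists l.
rewrite lamE in gk kE *; rewrite !lte_fin in gk kE.
apply/lee_addgt0Pr => e e0.
(* Trial spaces exist only strictly above the eigenvalue; L exceeds it by at most e and stays below
   E, so that nu > 1 / (E - g). *)
pose L := lam + Num.min e ((E - lam) / 2).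
have m0 : 0 < Num.min e ((E - lam) / 2).
  by rewrite lt_min e0 divr_gt0// subr_gt0.
have lamL : lam < L by rewrite ltrDl.
have LE : L < E.
  have : Num.min e ((E - lam) / 2) <= (E - lam) / 2 by rewrite ge_min lexx orbT.
  rewrite /L; lra.
have gL : 0 < L - g by rewrite subr_gt0 (lt_trans gk).
pose nu := (L - g)^-1; have nu0 : 0 < nu by rewrite invr_gt0.
have nuE : (E - g)^-1 < nu.
  by rewrite ltf_pV2 ?posrE ?subr_gt0 ?(lt_trans gk) ?ltrD2r// (lt_trans lamL).
suff h : (gap_eig T' g k <= (g + ((nu^-1 - kappa)^-1)^-1)%:E)%E.
  apply: le_trans (leeD h (lexx _)) _; rewrite -!EFinD lee_fin !invrK.
  have : Num.min e ((E - lam) / 2) <= e by rewrite ge_min lexx.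
  rewrite /L; lra.
have nlamL : (gap_eig T g k < L%:E)%E by rewrite lamE lte_fin.
case: k lamE nlamL => [k|] lamE nlamL /=.
  have [nk fa] := tr nu k nuE nu0 (enum_form_above Ts TS sE nlamL).
  by apply: (enum_le Ts' TS' sE') => //; rewrite invr_gt0.
have fa n := infty_form_above n Ts TS nlamL.
have [nk _] := tr nu 0%N nuE nu0 (fa 1%N).
apply: (infty_le Ts' TS'); first by rewrite invr_gt0.
case=> [|n]; first by exists (fun=> 0) => c [].
by have [] := tr nu n nuE nu0 (fa n.+1).
Qed.

Lemma proj_form_split p f x : proj p -> rlin f -> rsym f -> (forall y, f (p y) = p (f y)) ->
  rip x (f x) = rip (p x) (f (p x)) + rip (x - p x) (f (x - p x)).
Proof.
move=> [pl pp ps] fl fs fp; have h y : rip (p x) (f y) = rip (p x) (f (p y)).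
  by rewrite fp -ps pp.
rewrite (rlinB _ _ fl) !ripE -(fs (p x) x) [rip (f (p x)) x]ripC.
have -> : rip x (f (p x)) = rip (p x) (f x) by rewrite -fs ripC.
by rewrite (h x); ring.
Qed.

(* Cutting v down to Ran (Q - p0) removes a part on which S <= 0 and a part on
   which S <= m < nu, so the lower bound nu on the form of S survives. *)
Lemma window_bound (S : H -> H) (p0 Q : H -> H) (m nu : R) v : bop S -> proj p0 -> proj Q ->
  (forall x, p0 (Q x) = p0 x) ->
  (forall x, S (p0 x) = p0 (S x)) -> (forall x, S (Q x) = Q (S x)) ->
  (forall x, rip (p0 x) (S (p0 x)) <= 0) ->
  (forall x, Q x = 0 -> rip x (S x) <= m * nrm x ^+ 2) -> m < nu -> 0 < nu ->
  v <> 0 -> nu * nrm v ^+ 2 <= rip v (S v) ->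
  Q v - p0 v <> 0 /\ nu * nrm (Q v - p0 v) ^+ 2 <= rip (Q v - p0 v) (S (Q v - p0 v)).
Proof.
move=> [Sl Sb Ss] p0P QP p0Q S0 SQ S0n SQm mnu nu0 v0 hv.
have [Ql QQ Qs] := QP; have [pl pp ps] := p0P.
have idl : rlin (fun x => x) by []. have ids : rsym (fun x => x) by [].
have := proj_form_split (Q v) p0P idl ids (fun=> erefl).
have := proj_form_split v QP idl ids (fun=> erefl).
have := proj_form_split (Q v) p0P Sl Ss S0; have := proj_form_split v QP Sl Ss SQ.
rewrite p0Q !ripxx; have [c cE] : exists c, c = v - Q v by eexists.
have [a aE] : exists a, a = p0 v by eexists.
have [w wE] : exists w, w = Q v - p0 v by eexists.
rewrite -cE -wE => e1 e2 e3 e4.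
have c0 : Q c = 0 by rewrite cE (rlinB _ _ Ql) QQ subrr.
have h1 := SQm c c0; have h2 := S0n v.
have h3 : m * nrm c ^+ 2 <= nu * nrm c ^+ 2 by rewrite ler_wpM2r ?sqr_ge0// ltW.
have h4 : 0 <= nu * nrm (p0 v) ^+ 2 by rewrite mulr_ge0 ?sqr_ge0// ltW.
have expand : nu * nrm v ^+ 2 = nu * nrm (p0 v) ^+ 2 + nu * nrm w ^+ 2 + nu * nrm c ^+ 2.
  by rewrite e3 e4; ring.
split; last by lra.
(* Without the middle part the form of S at v is at most m |c|^2 with m < nu, which forces both
   remaining parts to vanish. *)
move=> w0; rewrite w0 rip0l nrm0 expr0n /= in e2 expand e4.
have k1 : nu * nrm (p0 v) ^+ 2 + (nu - m) * nrm c ^+ 2 <= 0 by lra.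
have k2 : 0 <= (nu - m) * nrm c ^+ 2 by rewrite mulr_ge0 ?sqr_ge0// subr_ge0 ltW.
have cn : nrm c ^+ 2 = 0.
  have : (nu - m) * nrm c ^+ 2 = 0 by apply/eqP; rewrite eq_le k2 andbT; lra.
  by move/eqP; rewrite mulf_eq0 subr_eq0 gt_eqF//= => /eqP.
have pn : nrm (p0 v) ^+ 2 = 0.
  have : nu * nrm (p0 v) ^+ 2 = 0 by apply/eqP; rewrite eq_le h4 andbT; lra.
  by move/eqP; rewrite mulf_eq0 gt_eqF//= => /eqP.
apply: v0; apply: nrm_eq0; apply/eqP; rewrite -sqrf_eq0 e3 e4 cn pn !addr0.
by [].
Qed.

(** Extracts finite constants: the distance may be infinite, and the midpoint b is positive even
    when B = 0. *)
Lemma opnorm_dist_left (B : {linear H -> H}) (g : R) (sp : set R) :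
  (opnorm B < dist_left g sp)%E -> exists b d : R, [/\ 0 < b, b < d,
    forall x, nrm (B x) <= b * nrm x & forall l, g - d < l -> l <= g -> ~ sp l].
Proof.
set N := opnorm B; set D := dist_left g sp => ND.
have N0 : (0 <= N)%E.
  apply: ereal_sup_ubound; exists 0; first by rewrite /= normr0 ler01.
  by rewrite linear0 normr0.
have [r rE] : exists r, N = r%:E.
  by case: N N0 ND => [r _ _|_|//]; [exists r|rewrite ltNge leey].
have [d rd dD] : exists2 d, r < d & (d%:E <= D)%E.
  move: ND; rewrite rE; case: D => [d||]; rewrite ?lte_fin//.
    by exists d.
  by exists (r + 1); rewrite ?ltrDl ?leey.
rewrite rE lee_fin in N0.
exists ((r + d) / 2), d; split; [by lra|by lra| |].
  move=> x; have [->|/nrm_gt0 x0] := pselect (x = 0).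
    by rewrite linear0 nrm0 mulr0.
  have : ((nrm (B (((nrm x)^-1)%:C *: x)))%:E <= N)%E.
    apply: ereal_sup_ubound; exists (((nrm x)^-1)%:C *: x) => //=.
    by rewrite nrmE nrmZ gtr0_norm ?invr_gt0// mulVf ?lt0r_neq0.
  rewrite rE lee_fin linearZ /= nrmZ gtr0_norm ?invr_gt0//.
  rewrite ler_pdivrMl// => h; apply: le_trans h _; rewrite mulrC ler_pM2r//; lra.
move=> l gl lg sl; have lM : (l%:E <= ereal_sup [set l%:E | l in sp `&` [set l | (l <= g)%R]])%E.
  by apply: ereal_sup_ubound; exists l.
move: dD lM; rewrite /D /dist_left; case: ereal_sup => [M||]//=.
by rewrite -EFinB !lee_fin; lra.
Qed.

(** * Comparison of the gap eigenvalues *)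

Lemma form_above_le (S S' : H -> H) nu n : (forall x, rip x (S x) <= rip x (S' x)) ->
  form_above S nu n -> form_above S' nu n.
Proof. by move=> SS' [e he]; exists e => c /he[v0 h]; split=> //; exact: le_trans (SS' _). Qed.

Lemma form_above_witness (S : H -> H) nu n : form_above S nu n.+1 ->
  exists v, v <> 0 /\ nu * nrm v ^+ 2 <= rip v (S v).
Proof.
move=> [e he]; have [|v0 hv] := he (fun=> 1); first by exists 0%N => //; exact: oner_neq0.
by exists (\sum_(i < n.+1) 1 *: e i).
Qed.

Section Bounds.
Variables (A : operator H) (g : R) (SA B : {linear H -> H}) (b theta : R).
Hypotheses (As : sym_op A) (ASA : is_res A g SA).
Hypotheses (Bs : symmetric_op ip B) (Bb : bop B).
Hypotheses (b0 : 0 < b) (th0 : 0 < theta) (thb : theta * b < 1).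
Hypothesis Bform : forall x, 0 <= rip x (B x) <= b * nrm x ^+ 2.
Hypothesis SAth : forall x, - theta * nrm x ^+ 2 <= rip x (SA x).

Lemma perturbed_res_le (C SB SC : {linear H -> H}) : rsym C ->
  (forall x, 0 <= rip x (C x)) -> (forall x, rip x (C x) <= rip x (B x)) ->
  is_res (op_add A B) g SB -> (forall x, SC x + SA (C (SC x)) = SA x) ->
  forall x, rip x (SB x) <= rip x (SC x).
Proof.
move=> Cs C0 CB TSB SCE; have [_ _ Bsym] := Bb.
apply: (@res_monotone SA SB SC B C b theta (res_bop As ASA)) => //; first exact: ltW.
  by move=> x; have /andP[] := Bform x.
exact: res_add_id ASA TSB.
Qed.

Lemma gap_eig_monotone (C : {linear H -> H}) : symmetric_op ip C -> bop C ->
  (forall x, 0 <= rip x (C x)) -> (forall x, rip x (C x) <= rip x (B x)) ->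
  forall E k, (gap_eig (op_add A B) g k < E%:E)%E ->
    (gap_eig (op_add A C) g k <= gap_eig (op_add A B) g k)%E.
Proof.
move=> Cs Cb C0 CB E k kE; have [_ _ Csym] := Cb.
have Cform x : 0 <= rip x (C x) <= b * nrm x ^+ 2.
  by rewrite C0 (le_trans (CB x)); have /andP[] := Bform x.
have [SB TSB] := res_add As ASA Bb b0 thb Bform SAth.
have [SC TSC] := res_add As ASA Cb b0 thb Cform SAth.
have le := perturbed_res_le Csym C0 CB TSB (res_add_id ASA TSC).
rewrite -[leLHS]adde0; apply: (gap_eig_transfer (op_add_sym As Bs) TSB (op_add_sym As Cs) TSC _ kE).
move=> nu n _ nu0 fa; rewrite subr0 invrK invr_gt0; split=> //.
exact: form_above_le le fa.
Qed.

Lemma form_shift_global (kappa nu : R) SB n : is_res (op_add A B) g SB -> 0 < kappa -> 0 < nu ->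
  (forall x, kappa * nrm x ^+ 2 <= rip x (B x)) -> form_above SB nu n.+1 ->
  kappa * nu < 1 /\ form_above SA (nu / (1 - kappa * nu)) n.+1.
Proof.
move=> TSB k0 nu0 Bk fa; pose K : {linear H -> H} := kappa%:C \*: idfun.
have KE x : K x = kappa%:C *: x by [].
have Kform x : rip x (K x) = kappa * nrm x ^+ 2 by rewrite KE ripZr ripxx.
have Kb : bop K.
  split; first exact: linear_rlin.
    by exists kappa => // x; rewrite KE nrmZ gtr0_norm.
  by move=> x y; rewrite !KE !ripE.
have [_ _ Ksym] := Kb.
(* The trial space supplies the nonzero vector that yields kappa <= b. *)
have [v [v0 hv]] := form_above_witness fa.
have kb : kappa <= b.
  have n0 : 0 < nrm v ^+ 2 by rewrite exprn_gt0 ?nrm_gt0.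
  by rewrite -(ler_pM2r n0); apply: le_trans (Bk v) _; have /andP[] := Bform v.
have Kge x : 0 <= rip x (K x) by rewrite Kform mulr_ge0 ?sqr_ge0// ltW.
have Kf x : 0 <= rip x (K x) <= b * nrm x ^+ 2 by rewrite Kge Kform ler_wpM2r ?sqr_ge0.
have [SK TSK] := res_add As ASA Kb b0 thb Kf SAth.
have KB x : rip x (K x) <= rip x (B x) by rewrite Kform.
have le := perturbed_res_le Ksym Kge KB TSB (res_add_id ASA TSK).
have kth : kappa * theta < 1.
  by apply: le_lt_trans thb; rewrite mulrC ler_pM2l.
have tr w : w <> 0 -> nu * nrm w ^+ 2 <= rip w (SB w) ->
    kappa * nu < 1 /\ nu / (1 - kappa * nu) * nrm w ^+ 2 <= rip w (SA w).
  move=> w0 hw; have n0 : 0 < nrm w ^+ 2 by rewrite exprn_gt0 ?nrm_gt0.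
  have [c1 c2] := scalar_shift_bound (res_bop As ASA) (linear_rlin SK) k0 kth SAth
    (res_add_id ASA TSK) le w0.
  exact: real_transfer hw c1 c2.
split; first by have [] := tr v v0 hv.
apply: (@form_above_map SB SA id n.+1 nu) fa => [//|w w0 hw]; split=> //.
by have [] := tr w w0 hw.
Qed.

Lemma form_shift_spectral (kappa nu E : R) P SB n : spectral_measure ip (op_add A B) P ->
  is_res (op_add A B) g SB -> g < E -> 0 < kappa -> (E - g)^-1 < nu ->
  (forall x, P `]-oo, E]%classic x = x -> kappa * nrm x ^+ 2 <= rip x (B x)) ->
  form_above SB nu n.+1 ->
  kappa * nu < 1 /\ form_above SA (nu / (1 - kappa * nu)) n.+1.
Proof.
move=> PT TSB gE k0 nuE BQ fa; have Ts := op_add_sym As Bs.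
have nu0 : 0 < nu by apply: lt_trans nuE; rewrite invr_gt0 subr_gt0.
have SBb := res_bop Ts TSB; have [_ _ Bsym] := Bb.
have [[p0l p0P Ql QP] [Qp0 p0Q] [S0 SQ] [Sneg Spos] Sup] := spectral_cut Ts PT TSB gE.
set p0 := P _ in p0l p0P Qp0 p0Q S0 Sneg Spos; set Q := P _ in Ql QP Qp0 p0Q SQ Sup BQ.
(* Comparison with the zero perturbation, whose resolvent is SA, gives SB <= SA. *)
pose Z : {linear H -> H} := 0%:C \*: idfun.
have ZE x : Z x = 0 by rewrite /= scale0r.
have mono : forall x, rip x (SB x) <= rip x (SA x).
  apply: (@perturbed_res_le Z) => //.
  - by move=> x y; rewrite !ZE rip0l rip0r.
  - by move=> x; rewrite ZE rip0r.
  - by move=> x; rewrite ZE rip0r; have /andP[] := Bform x.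
  - by move=> x; rewrite ZE linear0 addr0.
have [QL QQ _] := QP; have [pl pp _] := p0P.
have pl' : linear (fun v => Q v - p0 v).
  by move=> a x y; rewrite Ql p0l scalerBr opprD addrACA.
have tr w : w <> 0 -> nu * nrm w ^+ 2 <= rip w (SB w) -> Q w - p0 w <> 0 /\
    kappa * nu < 1 /\
    nu / (1 - kappa * nu) * nrm (Q w - p0 w) ^+ 2 <= rip (Q w - p0 w) (SA (Q w - p0 w)).
  move=> w0 hw; have [v0 hv] := window_bound SBb p0P QP p0Q S0 SQ Sneg Sup nuE nu0 w0 hw.
  split=> //; have [v vE] : exists v, v = Q w - p0 w by eexists.
  rewrite -vE in v0 hv *; have n0 : 0 < nrm v ^+ 2 by rewrite exprn_gt0 ?nrm_gt0.
  have p0v : p0 v = 0 by rewrite vE (rlinB _ _ pl) p0Q pp subrr.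
  have Qv : Q v = v by rewrite vE (rlinB _ _ QL) QQ Qp0.
  have a0 : 0 < rip v (SB v) by apply: lt_le_trans hv; rewrite mulr_gt0.
  have [c1 c2] := gap_shift_bound (res_bop As ASA) SBb Bb p0P Qp0 QL S0 SQ k0 b0 Sneg Spos
    Bform BQ mono (res_add_id ASA TSB) p0v Qv a0.
  exact: real_transfer hv c1 c2.
have [v [v0 hv]] := form_above_witness fa.
split; first by have [_ []] := tr v v0 hv.
apply: (@form_above_map SB SA (fun v => Q v - p0 v) n.+1 nu) fa => // w w0 hw.
by have [? []] := tr w w0 hw.
Qed.

Lemma gap_eig_shift (kappa E : R) : g < E ->
  (forall x, range (spectral_proj ip (op_add A B) E) x -> kappa * nrm x ^+ 2 <= rip x (B x)) ->
  forall k, (gap_eig (op_add A B) g k < E%:E)%E ->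
    (gap_eig A g k + kappa%:E <= gap_eig (op_add A B) g k)%E.
Proof.
move=> gE Bk k kE; have [SB TSB] := res_add As ASA Bb b0 thb Bform SAth.
apply: (gap_eig_transfer (op_add_sym As Bs) TSB As ASA _ kE) => nu n nuE nu0 fa.
(* For kappa <= 0 the target 1 / (1/nu - kappa) is at most nu, and SB <= SA suffices. *)
have [k0|k0] := leP kappa 0.
  have nk : nu^-1 <= nu^-1 - kappa by rewrite lerDl oppr_ge0.
  have nk0 : 0 < nu^-1 - kappa by apply: lt_le_trans nk; rewrite invr_gt0.
  split=> //; apply: (@form_aboveW _ nu).
    by rewrite -[leRHS]invrK lef_pV2 ?posrE ?invr_gt0.
  pose Z : {linear H -> H} := 0%:C \*: idfun.
  have ZE x : Z x = 0 by rewrite /= scale0r.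
  apply: form_above_le fa; apply: (@perturbed_res_le Z) => //.
  - by move=> x y; rewrite !ZE rip0l rip0r.
  - by move=> x; rewrite ZE rip0r.
  - by move=> x; rewrite ZE rip0r; have /andP[] := Bform x.
  - by move=> x; rewrite ZE linear0 addr0.
suff [kn fa'] : kappa * nu < 1 /\ form_above SA (nu / (1 - kappa * nu)) n.+1.
  have e : nu^-1 - kappa = (1 - kappa * nu) / nu by field; exact: lt0r_neq0.
  by rewrite e invf_div; split=> //; rewrite divr_gt0// subr_gt0.
have [[P PT]|nP] := pselect (exists P, spectral_measure ip (op_add A B) P).
  have PT' : spectral_measure ip (op_add A B) (the_spectral_measure ip (op_add A B)).
    by apply: (@xgetPex _ _ [set P | spectral_measure ip (op_add A B) P]); exists P.
  apply: (form_shift_spectral PT' TSB gE k0 nuE _ fa) => x Px.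
  by apply: Bk; exists x.
apply: (form_shift_global TSB k0 nu0 _ fa) => x; apply: Bk; exists x => //.
rewrite /spectral_proj /the_spectral_measure xgetPN// => P PT.
by apply: nP; exists P.
Qed.

End Bounds.

End RealForm.

Theorem theorem3p15 (R : realType) (H : completeNormedModType R[i])
    (ip : {dot H for (@Num.conj R[i])})
    (ip_norm : forall x : H, ip x x = `|x| ^+ 2)
    (H_infinite : infinite_dim [set: H])
    (A : operator H) (A_sa : self_adjoint ip A)
    (gamma : R) (gamma_res : resolvent_set A gamma%:C)
    (kappa : R)
    (B C : {linear H -> H})
    (B_bounded : continuous B) (B_sym : symmetric_op ip B)
    (C_bounded : continuous C) (C_sym : symmetric_op ip C)
    (C_ge0 : forall x : H, 0 <= ip x (C x))
    (C_le_B : forall x : H, ip x (C x) <= ip x (B x))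
    (B_small : (opnorm B < dist_left gamma (spectrum A))%E)
    (E : R) (E_gt : gamma < E) :
  ((forall x : H, range (spectral_proj ip (op_add A B) E) x ->
      kappa%:C * `|x| ^+ 2 <= ip x (B x)) ->
   forall k : option nat, (gap_eig (op_add A B) gamma k < E%:E)%E ->
     (gap_eig A gamma k + kappa%:E <= gap_eig (op_add A B) gamma k)%E)
  /\
  ((forall x : H, range (spectral_proj ip (op_add A B) E) x ->
      ip x (C x) <= ip x (B x)) ->
   forall k : option nat, (gap_eig (op_add A B) gamma k < E%:E)%E ->
     (gap_eig (op_add A C) gamma k <= gap_eig (op_add A B) gamma k)%E).
Proof.
have As := self_adjoint_sym A_sa; have [SA ASA] := gamma_res.
have sym_bop (F : {linear H -> H}) : continuous F -> symmetric_op ip F -> bop ip F.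
  move=> Fc Fs; split; [exact: linear_rlin|exact: continuous_bnd|].
  by move=> x y; rewrite /rip Fs.
have Bb := sym_bop B B_bounded B_sym; have Cb := sym_bop C C_bounded C_sym.
have [b [d [b0 bd Bb' gap]]] := opnorm_dist_left B_small.
have d0 : 0 < d by exact: lt_trans bd.
(* An inequality in [R[i]] combines equality of imaginary parts with the inequality of real parts,
   which is extracted here. *)
have C0 x : 0 <= rip ip x (C x) by have := C_ge0 x; rewrite lecE => /andP[].
have CB x : rip ip x (C x) <= rip ip x (B x) by have := C_le_B x; rewrite lecE => /andP[].
have Bform x : 0 <= rip ip x (B x) <= b * nrm x ^+ 2.
  by rewrite (le_trans (C0 x))//= form_le_nrm.
have th0 : 0 < d^-1 by rewrite invr_gt0.
have thb : d^-1 * b < 1 by rewrite mulrC ltr_pdivrMr// mul1r.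
have SAth := res_lower ip_norm As ASA d0 gap.
split=> hyp k kE; last first.
  exact: (gap_eig_monotone ip_norm As ASA B_sym Bb b0 th0 thb Bform SAth C_sym Cb C0 CB kE).
apply: (gap_eig_shift ip_norm As ASA B_sym Bb b0 th0 thb Bform SAth E_gt _ kE) => x Px.
by have := hyp x Px; rewrite (nrmE x) -rmorphXn -rmorphM lecE => /andP[].
Qed.
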